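(* Let $U$ be an open subset of a complex Banach space $E$ and let $v$ be a weight on $U$. Assume that the set $\mathbb{T}\,\mathrm{At}_{G^\infty_v(U)}=\{\lambda v(z)\delta_z : \lambda\in\mathbb{T},\ z\in U\}$ is a norm-closed set of uniformly strongly exposed points of the closed unit ball $B_{G^\infty_v(U)}$. Then $H^\infty_{vK}(U,F)$ has the $WH^\infty$-BPB property for every complex Banach space $F$.
   Context: Notation: $B_X$, $S_X$ are the closed unit ball and unit sphere of a Banach space $X$; $\mathbb{T}$ is the unit circle of $\mathbb{C}$. A weight on $U$ is a strictly positive continuous function on $U$. $H^\infty_v(U,F)$ is the Banach space of holomorphic mappings $f:U\to F$ with $\|f\|_v:=\sup\{v(z)\|f(z)\|: z\in U\}<\infty$; $H^\infty_v(U):=H^\infty_v(U,\mathbb{C})$. $H^\infty_{vK}(U,F)$ is the subspace of all $f\in H^\infty_v(U,F)$ such that $vf$ has relatively compact range in $F$, with the norm $\|\cdot\|_v$. $G^\infty_v(U)$ is the space of all linear functionals on $H^\infty_v(U)$ whose restriction to $B_{H^\infty_v(U)}$ is continuous for the compact-open topology; it is a closed subspace of $H^\infty_v(U)^*$, with the norm of $H^\infty_v(U)^*$. For $z\in U$, $\delta_z\in G^\infty_v(U)$ is the evaluation $\delta_z(f)=f(z)$. The atoms of $G^\infty_v(U)$ are the elements of $\mathrm{At}_{G^\infty_v(U)}=\{v(z)\delta_z: z\in U\}$. Uniformly strongly exposed points: for a complex Banach space $X$, $f\in S_{X^*}$ and $0<\delta<1$, put $S(B_X,f,\delta)=\{x\in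 B_X:\mathrm{Re}(f(x))>1-\delta\}$. A subset $S\subseteq S_X$ is a set of uniformly strongly exposed points of $B_X$ if there is a family $\{f_x: x\in S\}\subseteq S_{X^*}$ with $f_x(x)=1$ for every $x\in S$ such that, for every $0<\varepsilon<1$, there is $0<\delta<1$ with $\mathrm{diam}(S(B_X,f_x,\delta))<\varepsilon$ for all $x\in S$. $WH^\infty$-BPB property: a linear subspace $A\subseteq H^\infty_v(U,F)$ has the $WH^\infty$-BPB property if for every $0<\varepsilon<1$ there is $0<\eta(\varepsilon)<\varepsilon$ such that for every $f\in S_A$, every $\lambda\in\mathbb{T}$ and every $z\in U$ with $v(z)\|f(z)\|>1-\eta(\varepsilon)$, there exist $f_0\in S_A$, $\lambda_0\in\mathbb{T}$ and $z_0\in U$ such that $v(z_0)\|f_0(z_0)\|=1$, $\|f-f_0\|_v<\varepsilon$ and $\|\lambda v(z)\delta_z-\lambda_0v(z_0)\delta_{z_0}\|<\varepsilon$ (the last norm being that of $G^\infty_v(U)$). *)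

(* Defs.v *)
From HB Require Import structures.
From mathcomp Require Import all_boot all_order all_algebra.
From mathcomp Require Import complex.
From mathcomp Require Import all_classical all_reals all_analysis.

Set Implicit Arguments.
Unset Strict Implicit.
Unset Printing Implicit Defensive.

Import Order.TTheory GRing.Theory Num.Theory.
Import numFieldNormedType.Exports.

Local Open Scope classical_set_scope.
Local Open Scope ring_scope.
Local Open Scope complex_scope.

(* A complex normed space is a [normedModType R[i]].  Its library norm [`|x|]
   takes values in [R[i]]; these values are nonnegative reals, and [rnorm x] is
   the same number seen in [R].  The scalar field, seen as a normed space over
   itself, is [R[i]^o]. *)
Section RealNorm.
Context {R : realType} {V : normedModType R[i]}.
Implicit Types x y : V.

Definition rnorm x : R := complex.Re `|x|.

Lemma rnormE x : (rnorm x)%:C = `|x|.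
Proof. by apply: RRe_real; exact: normr_real. Qed.

Lemma rnorm_ge0 x : 0 <= rnorm x.
Proof. by rewrite -ler0c rnormE. Qed.

Lemma ler_rnormD x y : rnorm (x + y) <= rnorm x + rnorm y.
Proof. by rewrite -lecR rmorphD /= !rnormE ler_normD. Qed.

Lemma rnorm0 : rnorm (0 : V) = 0.
Proof. by rewrite /rnorm normr0. Qed.

Lemma rnorm0_eq0 x : rnorm x = 0 -> x = 0.
Proof. by move=> x0; apply/eqP; rewrite -normr_eq0 -rnormE x0. Qed.

Lemma rnormN x : rnorm (- x) = rnorm x.
Proof. by rewrite /rnorm normrN. Qed.

End RealNorm.

Lemma rnormZ {R : realType} {V : normedModType R[i]} (a : R[i]) (x : V) :
  rnorm (a *: x) = rnorm (a : R[i]^o) * rnorm x.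
Proof. by apply: complexI; rewrite rmorphM /= !rnormE normrZ. Qed.

Lemma rnorm_real {R : realType} (a : R) : 0 <= a -> rnorm (a%:C : R[i]^o) = a.
Proof. by move=> a0; apply: complexI; rewrite rnormE ger0_norm ?ler0c. Qed.

Definition closed_unit_ball {R : realType} (X : normedModType R[i]) : set X :=
  [set x | rnorm x <= 1].
Arguments closed_unit_ball {R} X.

Definition unit_sphere {R : realType} (X : normedModType R[i]) : set X :=
  [set x | rnorm x = 1].
Arguments unit_sphere {R} X.

(* [sup] of an unbounded set is 0, so [opnorm phi] is the usual norm of [phi]
   only when [phi] is bounded on the unit ball. *)
Definition opnorm {R : realType} {X : normedModType R[i]} (phi : X -> R[i]^o) : R :=
  sup [set rnorm (phi x) | x in closed_unit_ball X].

Definition dual_unit_sphere {R : realType} (X : normedModType R[i]) :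
    set {linear X -> R[i]^o} :=
  [set phi | continuous phi /\ opnorm phi = 1].
Arguments dual_unit_sphere {R} X.

Section OpNorm.
Context {R : realType} {X : normedModType R[i]}.
Implicit Types phi psi : X -> R[i]^o.

Let ball_bounded phi := has_ubound [set rnorm (phi x) | x in closed_unit_ball X].

Lemma opnorm_ub phi x :
  ball_bounded phi -> rnorm x <= 1 -> rnorm (phi x) <= opnorm phi.
Proof. by move=> bphi x1; apply: ub_le_sup => //; exists x. Qed.

Lemma opnorm_le phi M :
  (forall x, rnorm x <= 1 -> rnorm (phi x) <= M) -> opnorm phi <= M.
Proof.
move=> phiM; apply: ge_sup => [|_ [x x1 <-]]; last exact: phiM.
by exists (rnorm (phi 0)), 0 => //; rewrite /closed_unit_ball/= rnorm0.
Qed.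

Lemma ler_opnormD phi psi : ball_bounded phi -> ball_bounded psi ->
  opnorm (phi + psi) <= opnorm phi + opnorm psi.
Proof.
move=> bphi bpsi; apply: opnorm_le => x x1.
by apply: le_trans (ler_rnormD _ _) _; apply: lerD; exact: opnorm_ub.
Qed.

Lemma opnormZ a phi : ball_bounded phi ->
  opnorm (a *: phi) = rnorm (a : R[i]^o) * opnorm phi.
Proof.
move=> bphi; apply/eqP; rewrite eq_le; apply/andP; split.
  apply: opnorm_le => x x1; rewrite [X in rnorm X](_ : _ = a *: phi x)// rnormZ.
  by apply: ler_wpM2l; [exact: rnorm_ge0|exact: opnorm_ub].
have [->|a0] := eqVneq (rnorm (a : R[i]^o)) 0.
  rewrite mul0r; have [M bM] := bphi.
  apply: (@le_trans _ _ (rnorm ((a *: phi) 0))); first exact: rnorm_ge0.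
  apply: opnorm_ub; last by rewrite rnorm0.
  exists (rnorm (a : R[i]^o) * M) => _ [x x1 <-].
  rewrite [X in rnorm X](_ : _ = a *: phi x)// rnormZ.
  by apply: ler_wpM2l; [exact: rnorm_ge0|apply: bM; exists x].
have a_gt0 : 0 < rnorm (a : R[i]^o) by rewrite lt_def a0 rnorm_ge0.
rewrite mulrC -ler_pdivlMr//; apply: opnorm_le => x x1.
rewrite ler_pdivlMr// mulrC -rnormZ.
rewrite -[X in rnorm X]/((a *: phi) x); apply: opnorm_ub => //.
have [M bM] := bphi; exists (rnorm (a : R[i]^o) * M) => _ [y y1 <-].
rewrite [X in rnorm X](_ : _ = a *: phi y)// rnormZ.
by apply: ler_wpM2l; [exact: rnorm_ge0|apply: bM; exists y].
Qed.

Lemma opnorm0_eq0 phi : (forall a x, phi (a *: x) = a *: phi x) ->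
  ball_bounded phi -> opnorm phi = 0 -> phi = 0.
Proof.
move=> phiZ bphi phi0; apply/funext => x.
have [x0|x0] := eqVneq (rnorm x) 0; last first.
  have x_gt0 : 0 < rnorm x by rewrite lt_def x0 rnorm_ge0.
  have := @opnorm_ub phi ((rnorm x)^-1%:C *: x) bphi.
  rewrite phiZ !rnormZ rnorm_real ?invr_ge0 ?rnorm_ge0// mulVf// phi0.
  move=> /(_ (lexx _)); rewrite pmulr_rle0 ?invr_gt0// => phix.
  by apply: rnorm0_eq0; apply/eqP; rewrite eq_le phix rnorm_ge0.
by rewrite (rnorm0_eq0 x0) -(scale0r (0 : X)) phiZ scale0r.

Qed.

End OpNorm.

Section ExposedPoints.
Context {R : realType} (X : normedModType R[i]).

Definition slice (phi : X -> R[i]^o) (d : R) : set X :=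
  [set x | closed_unit_ball X x /\ 1 - d < complex.Re (phi x)].

(* Only applied to subsets of the unit ball, so the [sup] is that of a bounded
   set. *)
Definition diam (S : set X) : R := sup [set rnorm (x - y) | x in S & y in S].

(* The family [(f_x)_{x in S}] is a total map of which only the values on [S]
   matter. *)
Definition uniformly_strongly_exposed (S : set X) : Prop :=
  S `<=` unit_sphere X /\
  exists phi : X -> {linear X -> R[i]^o},
    (forall x, S x -> dual_unit_sphere X (phi x) /\ phi x x = 1) /\
    (forall eps : R, 0 < eps < 1 -> exists2 d : R, 0 < d < 1 &
       forall x, S x -> diam (slice (phi x) d) < eps).

End ExposedPoints.

Record weight {R : realType} {E : normedModType R[i]} (U : set E) := Weight {
  weight_fun :> E -> R;
  weight_gt0 : forall z, U z -> 0 < weight_fun z;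
  weight_continuous : {within U, continuous weight_fun}
}.

(* A map [U -> F] is encoded by its extension to [E] by 0 outside [U], so that
   Leibniz equality of elements of the space is equality on [U]; as [U] is open,
   differentiability (over [R[i]]) at the points of [U] is not affected. *)
Section WeightedHolomorphic.
Context {R : realType} {E : normedModType R[i]} {U : set E} (v : weight U).
Context (F : normedModType R[i]).

Definition Hinf_pred : {pred E -> F} := mem [set f : E -> F |
  [/\ forall z, U z -> differentiable f z,
      has_ubound [set v z * rnorm (f z) | z in U] &
      forall z, ~ U z -> f z = 0]].

Record Hinf := MkHinf { Hinf_fun :> E -> F; Hinf_mem : Hinf_fun \in Hinf_pred }.

HB.instance Definition _ := [isSub for Hinf_fun].
HB.instance Definition _ := [Choice of Hinf by <:].

Lemma Hinf_submod_closed : submod_closed Hinf_pred.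
Proof.
split=> [|a f g /set_mem[df [M bf] f0] /set_mem[dg [N bg] g0]]; apply/mem_set.
  split=> [z _|| //]; first exact: differentiable_cst.
  by exists 0 => _ [z _ <-]; rewrite [X in rnorm X](_ : _ = 0)// rnorm0 mulr0.
split=> [z Uz||z Uz].
- apply: differentiableD; last exact: dg.
  by apply: differentiableZ; exact: df.
- exists (rnorm (a : R[i]^o) * M + N) => _ [z Uz <-].
  have v0 := ltW (weight_gt0 v Uz).
  rewrite [X in rnorm X](_ : _ = a *: f z + g z)//.
  apply: (@le_trans _ _ (v z * (rnorm (a *: f z) + rnorm (g z)))).
    by apply: ler_wpM2l => //; exact: ler_rnormD.
  rewrite mulrDr rnormZ mulrCA; apply: lerD; last by apply: bg; exists z.
  by apply: ler_wpM2l; [exact: rnorm_ge0|apply: bf; exists z].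
- by rewrite [LHS](_ : _ = a *: f z + g z)// f0// g0// scaler0 addr0.
Qed.

HB.instance Definition _ :=
  GRing.isSubmodClosed.Build _ _ Hinf_pred Hinf_submod_closed.
HB.instance Definition _ := [SubChoice_isSubLmodule of Hinf by <:].

Definition Hinf_norm (f : Hinf) : R := sup [set v z * rnorm (f z) | z in U].

Lemma Hinf_norm_ub (f : Hinf) z : U z -> v z * rnorm (f z) <= Hinf_norm f.
Proof.
move=> Uz; have /set_mem[_ bf _] := Hinf_mem f.
by apply: ub_le_sup => //; exists z.
Qed.

Lemma Hinf_norm_le (f : Hinf) M : 0 <= M ->
  (forall z, U z -> v z * rnorm (f z) <= M) -> Hinf_norm f <= M.
Proof.
move=> M0 fM; rewrite /Hinf_norm; have [[z Uz]|U0] := pselect (U !=set0).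
  by apply: ge_sup => [|_ [w Uw <-]]; [exists (v z * rnorm (f z)), z|exact: fM].
suff -> : [set v z * rnorm (f z) | z in U] = set0 by rewrite sup0.
by apply/seteqP; split=> // x [z Uz _]; case: U0; exists z.
Qed.

Lemma Hinf_norm_ge0 f : 0 <= Hinf_norm f.
Proof.
have [[z Uz]|U0] := pselect (U !=set0).
  apply: le_trans (Hinf_norm_ub f Uz).
  by rewrite mulr_ge0 ?rnorm_ge0// ltW// weight_gt0.
rewrite /Hinf_norm; suff -> : [set v z * rnorm (f z) | z in U] = set0 by rewrite sup0.
by apply/seteqP; split=> // x [z Uz _]; case: U0; exists z.
Qed.

Lemma Hinf_normD f g :
  (Hinf_norm (f + g))%:C <= (Hinf_norm f)%:C + (Hinf_norm g)%:C.
Proof.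
rewrite -rmorphD /= lecR; apply: Hinf_norm_le => [|z Uz].
  by rewrite addr_ge0 ?Hinf_norm_ge0.
rewrite [X in rnorm X](_ : _ = f z + g z)//.
apply: le_trans (lerD (Hinf_norm_ub f Uz) (Hinf_norm_ub g Uz)).
by rewrite -mulrDr ler_wpM2l ?ler_rnormD// ltW// weight_gt0.
Qed.

Lemma Hinf_normZ_le (a : R[i]) f :
  Hinf_norm (a *: f) <= rnorm (a : R[i]^o) * Hinf_norm f.
Proof.
apply: Hinf_norm_le => [|z Uz]; first by rewrite mulr_ge0 ?rnorm_ge0 ?Hinf_norm_ge0.
rewrite [X in rnorm X](_ : _ = a *: f z)// rnormZ mulrCA.
by rewrite ler_wpM2l ?rnorm_ge0// Hinf_norm_ub.
Qed.

Lemma Hinf_normZ (a : R[i]) f :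
  (Hinf_norm (a *: f))%:C = `|a| * (Hinf_norm f)%:C.
Proof.
rewrite -[`|a|](@rnormE _ R[i]^o) -rmorphM /=; congr (_%:C); apply/eqP.
rewrite eq_le Hinf_normZ_le /=.
have [->|a0] := eqVneq a 0; first by rewrite rnorm0 mul0r Hinf_norm_ge0.
have a_gt0 : 0 < rnorm (a : R[i]^o).
  by rewrite -ltcR rnormE normr_gt0.
rewrite mulrC -ler_pdivlMr// mulrC.
have := Hinf_normZ_le a^-1 (a *: f).
rewrite scalerA mulVf// scale1r => /le_trans; apply.
rewrite ler_wpM2r ?Hinf_norm_ge0//.
by rewrite -lecR rnormE fmorphV /= rnormE normfV.
Qed.

Lemma Hinf_norm0_eq0 f : (Hinf_norm f)%:C = 0 -> f = 0.
Proof.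
move=> /complexI f0; apply: val_inj; apply/funext => z /=.
have /set_mem[_ _ foff] := Hinf_mem f.
have [Uz|nUz] := pselect (U z); last by rewrite foff.
have v0 := weight_gt0 v Uz.
apply: rnorm0_eq0; apply/eqP; rewrite eq_le rnorm_ge0 andbT.
by rewrite -(pmulr_rle0 _ v0) -f0 Hinf_norm_ub.
Qed.

HB.instance Definition _ :=
  Lmodule_isNormed.Build R[i] Hinf Hinf_normD Hinf_normZ Hinf_norm0_eq0.

Lemma rnorm_Hinf (f : Hinf) : rnorm f = Hinf_norm f.
Proof. by []. Qed.

(* [precompact] means having a compact closure, see [precompactE]. *)
Definition HinfK : set Hinf :=
  [set f | precompact [set (v z)%:C *: f z | z in U]].

End WeightedHolomorphic.

Arguments HinfK {R E U} v F.

Section Predual.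
Context {R : realType} {E : normedModType R[i]} {U : set E} (v : weight U).

Local Notation H := (Hinf v R[i]^o).

Definition Hinf_restr (f : H) : {compact-open, U -> R[i]^o} :=
  fun z => f (set_val z).

(* The same space with the compact-open topology of maps on [U] instead of the
   norm topology. *)
Definition Hinf_co : Type := initial_topology Hinf_restr.
HB.instance Definition _ := Topological.on Hinf_co.

(* Boundedness, hence finiteness of [opnorm], is a consequence: see
   [Ginf_bounded]. *)
Definition Ginf_pred : {pred H -> R[i]^o} := mem [set phi : H -> R[i]^o |
  linear phi /\
  {within (closed_unit_ball H : set Hinf_co), continuous (phi : Hinf_co -> R[i]^o)}].

Record Ginf := MkGinf { Ginf_fun :> H -> R[i]^o; Ginf_mem : Ginf_fun \in Ginf_pred }.

HB.instance Definition _ := [isSub for Ginf_fun].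
HB.instance Definition _ := [Choice of Ginf by <:].

Lemma Ginf_submod_closed : submod_closed Ginf_pred.
Proof.
split=> [|a p q /set_mem[lp cp] /set_mem[lq cq]]; apply/mem_set.
  split=> [b f g|]; last by move=> x; exact: cvg_cst.
  by rewrite /= scaler0 addr0.
split=> [b f g|x].
  rewrite [LHS](_ : _ = a *: p (b *: f + g) + q (b *: f + g))//.
  rewrite [in RHS](_ : (a *: p + q) f = a *: p f + q f)//.
  rewrite [in RHS](_ : (a *: p + q) g = a *: p g + q g)//.
  by rewrite lp lq !scalerDr !scalerA addrACA (mulrC a b).
by apply: cvgD; [apply: cvgZr; exact: cp|exact: cq].
Qed.

HB.instance Definition _ :=
  GRing.isSubmodClosed.Build _ _ Ginf_pred Ginf_submod_closed.
HB.instance Definition _ := [SubChoice_isSubLmodule of Ginf by <:].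

Lemma Ginf_linear (phi : Ginf) : linear phi.
Proof. by have /set_mem[] := Ginf_mem phi. Qed.

Lemma Ginf_scalable (phi : Ginf) a f : phi (a *: f) = a *: phi f.
Proof.
have l := Ginf_linear phi.
have phi0 : phi 0 = 0.
  have := l 1 0 0; rewrite !scale1r addr0 => /esym/eqP.
  by rewrite -subr_eq0 addrK => /eqP.
by rewrite -[X in phi X]addr0 l phi0 addr0.
Qed.

Lemma Ginf_continuous (phi : Ginf) :
  {within (closed_unit_ball H : set Hinf_co), continuous (phi : Hinf_co -> R[i]^o)}.
Proof. by have /set_mem[] := Ginf_mem phi. Qed.

(* [1 / v] is bounded on compact subsets of [U]. *)
Lemma weight_inv_bounded (K : set U) : compact K ->
  exists2 M : R, 0 < M & forall z : U, K z -> (v (set_val z))^-1 <= M.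
Proof.
move=> cK.
have cv : continuous (fun z : U => v (set_val z)).
  by have /subspace_sigL_continuousP := @weight_continuous _ _ _ v.
have cw : continuous (fun z : U => (v (set_val z))^-1).
  move=> z; apply: (@continuous_comp U R R (fun z => v (set_val z)) GRing.inv).
    exact: cv.
  apply: inv_continuous; have := weight_gt0 v (set_valP z).
  by rewrite lt0r => /andP[].
have /compact_bounded[M [_ MK]] : compact ((fun z : U => (v (set_val z))^-1) @` K).
  by apply: continuous_compact => //; exact: continuous_subspaceT.
exists (`|M| + 1) => [|z Kz]; first by rewrite ltr_wpDl.
apply: le_trans (ler_norm _) _; apply: (MK (`|M| + 1)); last by exists z.
by rewrite (le_lt_trans (ler_norm M))// ltrDl.
Qed.

Lemma Ginf_bounded (phi : Ginf) :
  has_ubound [set rnorm (phi f) | f in closed_unit_ball H].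
Proof.
apply: contrapT => nb.
have fP n : exists f : H, rnorm f <= 1 /\ n.+1%:R < rnorm (phi f).
  apply: contrapT => nf; apply: nb; exists n.+1%:R => _ [f f1 <-].
  by rewrite leNgt; apply/negP => nf'; apply: nf; exists f.
have [f fE] := choice fP.
pose g n : H := (n.+1%:R^-1 : R)%:C *: f n.
have rinv n : rnorm ((n.+1%:R^-1 : R)%:C : R[i]^o) = n.+1%:R^-1.
  by rewrite rnorm_real// invr_ge0.
have g1 n : rnorm (g n) <= 1.
  rewrite rnormZ rinv; apply: mulr_ile1; rewrite ?invr_ge0 ?rnorm_ge0//.
    by rewrite invf_le1 ?ltr0n// ler1n.
  by case: (fE n).
have phig n : 1 < rnorm (phi (g n)).
  rewrite Ginf_scalable rnormZ rinv mulrC ltr_pdivlMr ?ltr0n// mul1r.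
  by case: (fE n).
have g0 : (g n : Hinf_co) @[n --> \oo] --> (0 : Hinf_co).
  move=> A [B [[W oW <-] W0 sWA]]; apply: filterS sWA _.
  suff : Hinf_restr \o g @ \oo --> Hinf_restr 0 by apply; exact: open_nbhs_nbhs.
  have FF : Filter (Hinf_restr \o g @ \oo) by exact: fmap_filter.
  apply/(compact_open_cvgP _ FF) => K P cK oP KP.
  have [[z0 Kz0]|K0] := pselect (K !=set0); last first.
    by apply: filterE => h y [z Kz _]; case: K0; exists z.
  have P0 : P 0 by apply: KP; exists z0.
  have /nbhs_ballP[e /= e0 eP] : nbhs (0 : R[i]^o) P by exact: open_nbhs_nbhs.
  have [M M0 MK] := weight_inv_bounded cK.
  have eE : (complex.Re e)%:C = e by apply: RRe_real; exact: gtr0_real.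
  have re0 : 0 < complex.Re e by rewrite -ltcR eE.
  have reM : 0 < complex.Re e / M by rewrite divr_gt0.
  have := near_infty_natSinv_lt (PosNum reM).
  apply: filterS => n /= nM _ [z Kz <-]; apply: eP.
  rewrite -ball_normE /ball_ /= sub0r normrN -eE -rnormE ltcR.
  rewrite [X in rnorm X](_ : _ = (n.+1%:R^-1 : R)%:C *: f n (set_val z))//.
  rewrite rnormZ rinv; have vz := weight_gt0 v (set_valP z).
  apply: (@le_lt_trans _ _ (n.+1%:R^-1 * M)); last by rewrite -ltr_pdivlMr.
  apply: ler_wpM2l; first by rewrite invr_ge0.
  apply: le_trans (MK z Kz); rewrite -[leRHS]mul1r ler_pdivlMr// mulrC.
  by apply: le_trans (Hinf_norm_ub (f n) (set_valP z)) _; case: (fE n).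
have phi0 : phi 0 = 0 by rewrite -(scale0r (0 : H)) Ginf_scalable scale0r.
have b0 : closed_unit_ball H 0 by rewrite /closed_unit_ball/= rnorm0.
have b1 : nbhs (phi 0) (ball (0 : R[i]^o) 1).
  by rewrite phi0; apply: nbhsx_ballx; exact: ltr01.
have : within (closed_unit_ball H : set Hinf_co) (nbhs (0 : Hinf_co))
    (phi @^-1` ball (0 : R[i]^o) 1).
  by rewrite (@nbhs_subspace_in Hinf_co _ _ b0); exact: (@Ginf_continuous phi (0 : Hinf_co) _ b1).
move=> /g0 gn.
have /filter_ex[n /(_ (g1 n))] : \forall n \near \oo,
    closed_unit_ball H (g n) -> ball (0 : R[i]^o) 1 (phi (g n)) by exact: gn.
rewrite -ball_normE /ball_ /= sub0r normrN -rnormE.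
by rewrite -[1]/(1%:C) ltcR ltNge ltW.
Qed.

Lemma Ginf_opnormD (phi psi : Ginf) :
  (opnorm (phi + psi)%R)%:C <= (opnorm phi)%:C + (opnorm psi)%:C.
Proof.
by rewrite -rmorphD lecR; apply: ler_opnormD; exact: Ginf_bounded.
Qed.

Lemma Ginf_opnormZ a (phi : Ginf) :
  (opnorm (a *: phi)%R)%:C = `|a| * (opnorm phi)%:C.
Proof.
rewrite -[`|a|](@rnormE _ R[i]^o) -rmorphM; congr (_%:C).
by apply: opnormZ; exact: Ginf_bounded.
Qed.

Lemma Ginf_opnorm0_eq0 (phi : Ginf) : (opnorm phi)%:C = 0 -> phi = 0.
Proof.
move=> /complexI phi0; apply: val_inj; apply: opnorm0_eq0 => //.
- by move=> a f; exact: Ginf_scalable.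
- exact: Ginf_bounded.
Qed.

HB.instance Definition _ :=
  Lmodule_isNormed.Build R[i] Ginf Ginf_opnormD Ginf_opnormZ Ginf_opnorm0_eq0.

Lemma delta_Ginf z : (fun f : H => f z) \in Ginf_pred.
Proof.
apply/mem_set; split=> [a f g //|].
have [Uz|nUz] := pselect (U z); last first.
  rewrite (_ : (fun f : H => f z) = cst 0); first by move=> ?; exact: cvg_cst.
  by apply/funext => f; have /set_mem[_ _ ->] := Hinf_mem f.
pose z' : U := exist _ z (mem_set Uz).
pose ev (h : {compact-open, U -> R[i]^o}) : R[i]^o := h z'.
have cev : continuous ev.
  move=> h A; rewrite nbhsE => -[B [oB Bh] BA].
  have cz : compact [set z'] by exact: compact_set1.
  rewrite nbhsE /=; exists [set g | g @` [set z'] `<=` B].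
    split; first exact: compact_open_open.
    by move=> _ [_ -> <-].
  by move=> g gB; apply: BA; apply: gB; exists z'.
have : continuous (ev \o (Hinf_restr : Hinf_co -> {compact-open, U -> R[i]^o})).
  by move=> f; apply: continuous_comp; [exact: initial_continuous|exact: cev].
by move=> c; exact: continuous_subspaceT c.
Qed.

(* Outside [U] this is the zero functional. *)
Definition delta z : Ginf := MkGinf (delta_Ginf z).

Definition atom z : Ginf := (v z)%:C *: delta z.

Definition circle_atoms : set Ginf :=
  [set l *: atom z | l in [set l : R[i] | `|l| = 1] & z in U].

End Predual.

Arguments circle_atoms {R E U} v.

Definition WHinf_BPB {R : realType} {E : normedModType R[i]} {U : set E}
    {v : weight U} {F : normedModType R[i]} (A : set (Hinf v F)) : Prop :=
  forall eps : R, 0 < eps < 1 -> exists2 eta : R, 0 < eta < eps &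
    forall (f : Hinf v F) (l : R[i]) (z : E),
      A f -> rnorm f = 1 -> `|l| = 1 -> U z -> 1 - eta < v z * rnorm (f z) ->
      exists (f0 : Hinf v F) (l0 : R[i]) (z0 : E),
        [/\ A f0, rnorm f0 = 1, `|l0| = 1 & U z0] /\
        [/\ v z0 * rnorm (f0 z0) = 1, rnorm (f - f0) < eps &
            rnorm (l *: atom v z - l0 *: atom v z0) < eps].

(* Main.v *)
(* Evaluation z |-> delta_z is holomorphic into the predual G: by the Cauchy
   inequalities the Taylor remainders of the functions of the unit ball are
   bounded uniformly.  Hence a bounded operator T : G -> F gives a function
   T o delta of the weighted space, and an exposing functional phi in G* gives
   the rank-one perturbations (phi o delta) y.  Starting from f and a near
   maximiser x_0 = l atom(z), add at step n a small multiple of phi_n y_n, where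
   phi_n exposes x_n and y_n is the direction of the value of the current
   function at x_n.  The near maximisers of the new function must lie, up to
   rotation, in a thin slice around x_n, and x_{n+1} is chosen among them.  The
   x_n form a Cauchy sequence whose limit is an atom since the atoms are closed,
   and the limit function, which is f + T o delta with T compact, attains its
   norm there. *)
From HB Require Import structures.
Require Import Defs.
From mathcomp Require Import all_boot all_order all_algebra.
From mathcomp Require Import complex lra ring finmap.
From mathcomp Require Import all_classical all_reals all_analysis.

Set Implicit Arguments.
Unset Strict Implicit.
Unset Printing Implicit Defensive.

Import Order.TTheory GRing.Theory Num.Theory.
Import numFieldNormedType.Exports.
Local Open Scope classical_set_scope.
Local Open Scope ring_scope.
Local Open Scope complex_scope.

(** * The divergence theorem for pointwise differentiable planar fields *)

Section IntervalIntegral.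
Context {R : realType}.
Implicit Types (a b m k l : R) (h : R -> R).

(** The function [f] itself is never turned into an operator on the predual: only the perturbation
    is. Each stage therefore carries a function together with an operator, and compactness is asked
    only of rank-one terms and of norm limits. Composing with a norming functional of [F] shows that
    the weighted values of a function at two rotated atoms differ by at most its norm times the
    distance of the atoms; this carries near maximality along the Cauchy sequence of atoms to its
    limit. A thin slice suffices because the perturbation adds its full size [rho] to the norm of
    the value at the exposed atom, while at any other atom it adds at most [rho] times the modulus
    of the exposing functional there. Uniform exposure fixes all slice widths, hence the final
    [eta], before [f] is given. Holomorphy of the evaluation needs Cauchy estimates for functions
    known only to be complex differentiable at each point; with no continuity of the derivative at
    hand, they start from Goursat's bisection. *)

Definition cont_on a b h := forall x, a <= x <= b -> {for x, continuous h}.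

Definition itvint a b h : R := \int[@lebesgue_measure R]_(x in `[a, b]) h x.

Lemma cont_on_integrable a b h : cont_on a b h ->
  (@lebesgue_measure R).-integrable `[a, b] (EFin \o h).
Proof.
move=> ch; apply: continuous_compact_integrable; first exact: segment_compact.
by apply: continuous_in_subspaceT => x; rewrite inE /= in_itv => /ch.
Qed.

Lemma cont_on_sub a b c d h : cont_on a b h -> a <= c -> d <= b -> cont_on c d h.
Proof.
move=> ch ac db x /andP[cx xd]; apply: ch.
by rewrite (le_trans ac)//= (le_trans xd).
Qed.

Lemma cont_onB a b h1 h2 : cont_on a b h1 -> cont_on a b h2 ->
  cont_on a b (fun x => h1 x - h2 x).
Proof. by move=> c1 c2 x xab; apply: cvgB; [exact: c1|exact: c2]. Qed.

Lemma itvint_split a m b h : a <= m <= b -> cont_on a b h ->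
  itvint a b h = itvint a m h + itvint m b h.
Proof.
move=> /andP[am mb] ch; have ih := cont_on_integrable ch.
have := @Rintegral_itvB _ h (BLeft a) (BRight b) m ih.
rewrite !bnd_simp => /(_ am mb).
rewrite Rintegral_itv_obnd_cbnd; last first.
  apply: integrableS ih => //; apply: subset_itvr.
  by rewrite bnd_simp.
by rewrite /itvint => <-; rewrite addrC subrK.
Qed.

Lemma itvintB a b h1 h2 : cont_on a b h1 -> cont_on a b h2 ->
  itvint a b (fun x => h1 x - h2 x) = itvint a b h1 - itvint a b h2.
Proof. by move=> c1 c2; rewrite /itvint RintegralB//; exact: cont_on_integrable. Qed.

Lemma itvint_cst a b k : a <= b -> itvint a b (fun=> k) = k * (b - a).
Proof.
move=> ab; rewrite /itvint Rintegral_cst//= lebesgue_measure_itv /= lte_fin.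
move: ab; rewrite le_eqVlt => /predU1P[->|->].
  by rewrite ltxx subrr.
by rewrite -EFinB.
Qed.

Lemma itvint_bounds a b h k l : a <= b -> cont_on a b h ->
  (forall x, a <= x <= b -> k <= h x <= l) ->
  k * (b - a) <= itvint a b h <= l * (b - a).
Proof.
move=> ab ch kl; rewrite -!itvint_cst//; apply/andP; split; apply: le_Rintegral => //.
- by apply: cont_on_integrable => x _; exact: cvg_cst.
- exact: cont_on_integrable.
- by move=> x /=; rewrite in_itv => /kl /andP[].
- exact: cont_on_integrable.
- by apply: cont_on_integrable => x _; exact: cvg_cst.
- by move=> x /=; rewrite in_itv => /kl /andP[].
Qed.

Lemma itvint_dist a b h k e : a <= b -> cont_on a b h ->
  (forall x, a <= x <= b -> `|h x - k| <= e) ->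
  `|itvint a b h - k * (b - a)| <= e * (b - a).
Proof.
move=> ab ch hk.
have /(itvint_bounds ab ch)/andP[h1 h2] x : a <= x <= b -> k - e <= h x <= k + e.
  by move=> /hk; rewrite ler_distl.
by rewrite ler_distl -mulrBl h1 -mulrDl h2.
Qed.

End IntervalIntegral.

Section Goursat.
Context {R : realType}.
Implicit Types (P Q : R -> R -> R) (x y a b c d p q e : R).

(** Fréchet differentiability at one point, with partial derivatives [p] and [q]. Nothing is asked
    of the partial derivatives at other points. *)
Definition pdiff P x y p q := forall e, 0 < e -> exists2 d, 0 < d &
  forall x' y', `|x' - x| < d -> `|y' - y| < d ->
    `|P x' y' - P x y - p * (x' - x) - q * (y' - y)| <= e * (`|x' - x| + `|y' - y|).

Lemma pdiff_cont P x y p q : pdiff P x y p q ->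
  {for x, continuous (P^~ y)} /\ {for y, continuous (P x)}.
Proof.
move=> dP; have [d d0 dE] := dP _ ltr01.
have pq0 : 0 < 1 + `|p| + `|q| by rewrite !ltr_wpDr.
have key x' y' : `|x' - x| < d -> `|y' - y| < d ->
    `|P x' y' - P x y| <= (1 + `|p| + `|q|) * (`|x' - x| + `|y' - y|).
  move=> xd yd; rewrite -(subrK (p * (x' - x) + q * (y' - y)) (_ - _)).
  apply: le_trans (ler_normD _ _) _.
  rewrite -(addrA 1) mulrDl; apply: lerD; first by rewrite opprD addrA; exact: dE.
  apply: le_trans (ler_normD _ _) _; rewrite !normrM.
  have := mulr_ge0 (normr_ge0 p) (normr_ge0 (y' - y)).
  have := mulr_ge0 (normr_ge0 q) (normr_ge0 (x' - x)) ; lra.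
split; apply/cvgrPdist_le => /= e e0.
- near=> x'; rewrite distrC; apply: le_trans (key _ _ _ _) _.
  + by rewrite distrC; near: x'; exact: cvgr_dist_lt.
  + by rewrite subrr normr0.
  + rewrite subrr normr0 addr0 mulrC -ler_pdivlMr// distrC; near: x'.
    by apply: cvgr_dist_le => //; rewrite divr_gt0.
- near=> y'; rewrite distrC; apply: le_trans (key _ _ _ _) _.
  + by rewrite subrr normr0.
  + by rewrite distrC; near: y'; exact: cvgr_dist_lt.
  + rewrite subrr normr0 add0r mulrC -ler_pdivlMr// distrC; near: y'.
    by apply: cvgr_dist_le => //; rewrite divr_gt0.
Unshelve. all: by end_near. Qed.

(* The outward flux of the vector field [(P, Q)] through the boundary of the
   rectangle [[a, b] * [c, d]]. *)
Definition flux P Q a b c d : R :=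
  itvint c d (fun y => P b y - P a y) + itvint a b (fun x => Q x d - Q x c).

Lemma flux_cutx P Q a m b c d : a <= m <= b ->
  cont_on c d (P a) -> cont_on c d (P m) -> cont_on c d (P b) ->
  cont_on a b (Q^~ c) -> cont_on a b (Q^~ d) ->
  flux P Q a b c d = flux P Q a m c d + flux P Q m b c d.
Proof.
move=> amb Pa Pm Pb Qc Qd; rewrite /flux.
rewrite (itvint_split amb (cont_onB Qd Qc)).
by rewrite !(@itvintB _ c d)//; ring.
Qed.

Lemma flux_cuty P Q a b c m d : c <= m <= d ->
  cont_on a b (Q^~ c) -> cont_on a b (Q^~ m) -> cont_on a b (Q^~ d) ->
  cont_on c d (P a) -> cont_on c d (P b) ->
  flux P Q a b c d = flux P Q a b c m + flux P Q a b m d.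
Proof.
move=> cmd Qc Qm Qd Pa Pb; rewrite /flux.
rewrite (itvint_split cmd (cont_onB Pb Pa)).
by rewrite !(@itvintB _ a b)//; ring.
Qed.

Section Rectangle.
Variables (P Q : R -> R -> R) (a b c d : R).
Hypothesis ab : a <= b.
Hypothesis cd : c <= d.
(** The opposite diagonal partials [p] and [- p] say that the field [(P, Q)] has zero divergence at
    each point. *)
Hypothesis dPQ : forall x y, a <= x <= b -> c <= y <= d ->
  exists p q r, pdiff P x y p q /\ pdiff Q x y r (- p).

Let contP x : a <= x <= b -> cont_on c d (P x).
Proof.
by move=> xab y ycd; have [p [q [r [/pdiff_cont[] ]]]] := dPQ xab ycd.
Qed.

Let contQ y : c <= y <= d -> cont_on a b (Q^~ y).
Proof.
by move=> ycd x xab; have [p [q [r [_ /pdiff_cont[] ]]]] := dPQ xab ycd.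
Qed.

Let w n := (b - a) / 2 ^+ n.
Let h n := (d - c) / 2 ^+ n.
Let F n (s : R * R) := flux P Q s.1 (s.1 + w n) s.2 (s.2 + h n).
Let inside n (s : R * R) := [&& a <= s.1, s.1 + w n <= b, c <= s.2 & s.2 + h n <= d].

Let wS n : w n = w n.+1 + w n.+1.
Proof. by rewrite /w exprS; field; rewrite expf_neq0. Qed.

Let hS n : h n = h n.+1 + h n.+1.
Proof. by rewrite /h exprS; field; rewrite expf_neq0. Qed.

Let w0 n : 0 <= w n. Proof. by rewrite divr_ge0 ?subr_ge0// exprn_ge0. Qed.
Let h0 n : 0 <= h n. Proof. by rewrite divr_ge0 ?subr_ge0// exprn_ge0. Qed.

Let quarters n s : inside n s ->
  F n s = F n.+1 s + F n.+1 (s.1 + w n.+1, s.2)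
        + (F n.+1 (s.1, s.2 + h n.+1) + F n.+1 (s.1 + w n.+1, s.2 + h n.+1)).
Proof.
case: s => x y /and4P[/= ax xb cy yd]; rewrite /F /=.
have := w0 n.+1; have := h0 n.+1; have := wS n; have := hS n => hn wn hp wp.
have cP x' : x <= x' <= x + w n -> cont_on y (y + h n) (P x').
  by move=> ?; apply: cont_on_sub (contP _) _ _ => //; lra.
have cQ y' : y <= y' <= y + h n -> cont_on x (x + w n) (Q^~ y').
  by move=> ?; apply: cont_on_sub (contQ _) _ _ => //; lra.
have cut y1 y2 : y <= y1 -> y1 <= y2 -> y2 <= y + h n ->
    flux P Q x (x + w n) y1 y2
    = flux P Q x (x + w n.+1) y1 y2 + flux P Q (x + w n.+1) (x + w n) y1 y2.
  move=> yy1 y12 y2y; apply: flux_cutx; first lra.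
  - by apply: cont_on_sub (cP _ _) _ _ => //; lra.
  - by apply: cont_on_sub (cP _ _) _ _ => //; lra.
  - by apply: cont_on_sub (cP _ _) _ _ => //; lra.
  - by apply: cQ; lra.
  - by apply: cQ; lra.
rewrite (@flux_cuty _ _ _ _ _ (y + h n.+1)).
- rewrite !cut; try lra.
  by rewrite wn hn !addrA.
- lra.
- by apply: cQ; lra.
- by apply: cQ; lra.
- by apply: cQ; lra.
- by apply: cP; lra.
- by apply: cP; lra.
Qed.

Let step n s (g : R) : inside n s -> g <= `|F n s| ->
  exists s', [/\ inside n.+1 s', g / 4 <= `|F n.+1 s'|,
    s.1 <= s'.1, s'.1 + w n.+1 <= s.1 + w n &
    s.2 <= s'.2 /\ s'.2 + h n.+1 <= s.2 + h n].
Proof.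
move=> ins gF; have := quarters ins.
have := w0 n.+1; have := h0 n.+1; have := wS n; have := hS n => hn wn hp wp.
case: s ins gF => x y /and4P[/= ax xb cy yd] gF E.
set s1 := (x, y) in E; set s2 := (x + w n.+1, y) in E.
set s3 := (x, y + h n.+1) in E; set s4 := (x + w n.+1, y + h n.+1) in E.
have [g1|g1] := leP (g / 4) `|F n.+1 s1|.
  exists s1; rewrite /inside /s1 /=; split; [lra|done|lra|lra|split; lra].
have [g2|g2] := leP (g / 4) `|F n.+1 s2|.
  exists s2; rewrite /inside /s2 /=; split; [lra|done|lra|lra|split; lra].
have [g3|g3] := leP (g / 4) `|F n.+1 s3|.
  exists s3; rewrite /inside /s3 /=; split; [lra|done|lra|lra|split; lra].
have [g4|g4] := leP (g / 4) `|F n.+1 s4|.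
  exists s4; rewrite /inside /s4 /=; split; [lra|done|lra|lra|split; lra].
have := ler_normD (F n.+1 s1 + F n.+1 s2) (F n.+1 s3 + F n.+1 s4).
have := ler_normD (F n.+1 s1) (F n.+1 s2).
have := ler_normD (F n.+1 s3) (F n.+1 s4).
rewrite -E; lra.
Qed.

(** At first order [P] contributes [p * w n * h n] to the flux and [Q] its opposite. Only the
    remainders survive: they are of order [e * (w n + h n)], along sides of total length of order
    [w n + h n]. *)
Let local_small x y : a <= x <= b -> c <= y <= d -> forall e, 0 < e ->
  exists2 k, 0 < k & forall n s, inside n s -> w n < k -> h n < k ->
    s.1 <= x <= s.1 + w n -> s.2 <= y <= s.2 + h n ->
    `|F n s| <= e * (w n + h n) ^+ 2.
Proof.
move=> xab ycd e e0; have [p [q [r [dP dQ]]]] := dPQ xab ycd.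
(* Each integrand of the flux is a difference of two values, and each value brings its own
   remainder. *)
have e20 : 0 < e / 2 by rewrite divr_gt0.
have [k1 k10 P1] := dP _ e20; have [k2 k20 Q2] := dQ _ e20.
exists (Num.min k1 k2) => [|n [x1 y1] /and4P[/= ax xb cy yd]].
  by rewrite lt_min k10.
rewrite !lt_min => /andP[wk1 wk2] /andP[hk1 hk2] xx yy.
have := w0 n; have := h0 n => hp wp.
rewrite /F /flux /=; set X := itvint _ _ _; set Y := itvint _ _ _.
have dw x' : x1 <= x' <= x1 + w n -> `|x' - x| <= w n.
  by move=> ?; rewrite ler_distl; lra.
have dh y' : y1 <= y' <= y1 + h n -> `|y' - y| <= h n.
  by move=> ?; rewrite ler_distl; lra.
have x1i : x1 <= x1 <= x1 + w n by lra.
have x2i : x1 <= x1 + w n <= x1 + w n by lra.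
have y1i : y1 <= y1 <= y1 + h n by lra.
have y2i : y1 <= y1 + h n <= y1 + h n by lra.
have P1' x' y' : x1 <= x' <= x1 + w n -> y1 <= y' <= y1 + h n ->
    `|P x' y' - P x y - p * (x' - x) - q * (y' - y)| <= e / 2 * (w n + h n).
  move=> /dw xw /dh yh; apply: le_trans (P1 _ _ _ _) _.
  - exact: le_lt_trans xw wk1.
  - exact: le_lt_trans yh hk1.
  - by rewrite ler_pM2l// lerD.
have Q2' x' y' : x1 <= x' <= x1 + w n -> y1 <= y' <= y1 + h n ->
    `|Q x' y' - Q x y - r * (x' - x) - - p * (y' - y)| <= e / 2 * (w n + h n).
  move=> /dw xw /dh yh; apply: le_trans (Q2 _ _ _ _) _.
  - exact: le_lt_trans xw wk2.
  - exact: le_lt_trans yh hk2.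
  - by rewrite ler_pM2l// lerD.
have HX : `|X - (p * w n) * (y1 + h n - y1)| <= (e * (w n + h n)) * (y1 + h n - y1).
  apply: itvint_dist; first lra.
    by apply: cont_onB; apply: cont_on_sub (contP _) _ _ => //; lra.
  move=> y' yi.
  have := P1' _ _ x2i yi; have := P1' _ _ x1i yi.
  by rewrite !ler_norml; lra.
have HY : `|Y - (- p * h n) * (x1 + w n - x1)| <= (e * (w n + h n)) * (x1 + w n - x1).
  apply: itvint_dist; first lra.
    by apply: cont_onB; apply: cont_on_sub (contQ _) _ _ => //; lra.
  move=> x' xi.
  have := Q2' _ _ xi y2i; have := Q2' _ _ xi y1i.
  by rewrite !ler_norml; lra.
by move: HX HY; rewrite !ler_norml; lra.
Qed.

(* Bisection: a nonzero flux would survive, up to a factor [4 ^ n], in a sequence of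
   nested rectangles shrinking to a point, where the divergence vanishes. *)
Theorem goursat_flux : flux P Q a b c d = 0.
Proof.
apply/eqP; rewrite -normr_eq0; apply/negPn/negP => F0.
set g := `|_| in F0; have {F0}g0 : 0 < g by rewrite lt_def F0 normr_ge0.
pose good n s := inside n s /\ g / 4 ^+ n <= `|F n s|.
have nxtP (ns : nat * (R * R)) : exists s', good ns.1 ns.2 ->
    [/\ good ns.1.+1 s', ns.2.1 <= s'.1, s'.1 + w ns.1.+1 <= ns.2.1 + w ns.1 &
      ns.2.2 <= s'.2 /\ s'.2 + h ns.1.+1 <= ns.2.2 + h ns.1].
  case: ns => n s /=; have [[ins gs]|ng] := pselect (good n s); last by exists s.
  have [s' [i1 i2 i3 i4 i5]] := step ins gs; exists s' => _; split=> //; split=> //.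
  by rewrite exprSr invfM mulrA.
have [nxt nxtE] := choice nxtP.
pose s := fix s n := if n is m.+1 then nxt (m, s m) else (a, c).
have sgood n : good n (s n).
  elim: n => [|n IHn]; last by have [] := nxtE (n, s n) IHn.
  have w0E : a + w 0 = b by rewrite /w expr0 divr1 addrC subrK.
  have h0E : c + h 0 = d by rewrite /h expr0 divr1 addrC subrK.
  by split; rewrite /inside /F /= ?w0E ?h0E ?lexx// expr0 divr1.
have sstep n := nxtE (n, s n) (sgood n).
have mono m n : [/\ (s m).1 <= (s (m + n)%N).1, (s (m + n)%N).1 + w (m + n)%N <= (s m).1 + w m,
   (s m).2 <= (s (m + n)%N).2 & (s (m + n)%N).2 + h (m + n)%N <= (s m).2 + h m].
  elim: n => [|n [i1 i2 i3 i4]]; first by rewrite addn0.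
  rewrite addnS; have [_ /= j1 j2 [j3 j4]] := sstep (m + n)%N.
  by split; [apply: le_trans j1|apply: le_trans j2 _|apply: le_trans j3|apply: le_trans j4 _].
have cross m n : (s m).1 <= (s n).1 + w n /\ (s m).2 <= (s n).2 + h n.
  have [mn|nm] := leqP m n.
    have [i1 i2 i3 i4] := mono m (n - m)%N; rewrite subnKC// in i1 i2 i3 i4.
    by have := w0 n; have := h0 n; split; lra.
  have [i1 i2 i3 i4] := mono n (m - n)%N; rewrite subnKC ?(ltnW nm)// in i1 i2 i3 i4.
  by have := w0 m; have := h0 m; split; lra.
(* The lower left corners increase and stay below every upper right corner, so their suprema give a
   point common to all the rectangles. *)
pose X := sup [set (s n).1 | n in setT]; pose Y := sup [set (s n).2 | n in setT].
have Xn n : (s n).1 <= X <= (s n).1 + w n.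
  apply/andP; split.
    apply: ub_le_sup; last by exists n.
    by exists ((s 0).1 + w 0) => _ [m _ <-]; case: (cross m 0).
  apply: ge_sup; first by exists (s 0).1, 0.
  by move=> _ [m _ <-]; case: (cross m n).
have Yn n : (s n).2 <= Y <= (s n).2 + h n.
  apply/andP; split.
    apply: ub_le_sup; last by exists n.
    by exists ((s 0).2 + h 0) => _ [m _ <-]; case: (cross m 0).
  apply: ge_sup; first by exists (s 0).2, 0.
  by move=> _ [m _ <-]; case: (cross m n).
have Xab : a <= X <= b.
  have [/and4P[? ? _ _] _] := sgood 0; have := Xn 0%N; lra.
have Ycd : c <= Y <= d.
  have [/and4P[_ _ ? ?] _] := sgood 0; have := Yn 0%N; lra.
pose L := (b - a) + (d - c).
have L0 : 0 <= L by rewrite /L; lra.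
(* Chosen so that [e * L ^+ 2 < g]: the factor [4 ^+ n] lost by the flux cancels against the one in
   the squared side lengths. *)
pose e := g / (2 * (L ^+ 2 + 1)).
have L20 : 0 < 2 * (L ^+ 2 + 1) by have := sqr_ge0 L; lra.
have e0 : 0 < e by rewrite divr_gt0.
have [k k0 kP] := local_small Xab Ycd e0.
have [n Ln] : exists n, L / 2 ^+ n < k.
  have Lk0 : 0 <= L / k by rewrite divr_ge0// ltW.
  exists (Num.bound (L / k)); rewrite ltr_pdivrMr ?exprn_gt0//.
  rewrite mulrC -ltr_pdivrMr//; apply: lt_trans (archi_boundP Lk0) _.
  by rewrite -natrX ltr_nat ltn_expl.
have wh : w n + h n = L / 2 ^+ n by rewrite /w /h /L -mulrDl.
have [ins gn] := sgood n.
have := kP n (s n) ins; rewrite wh.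
have := w0 n; have := h0 n => hp wp.
move=> /(_ _ _ (Xn n) (Yn n)) FL.
have {FL} : `|F n (s n)| <= e * (L / 2 ^+ n) ^+ 2 by apply: FL; lra.
move=> /(le_trans gn); rewrite expr_div_n exprAC -[2 ^+ 2]/(2 * 2 : R).
have -> : 2 * 2 = 4 :> R by ring.
rewrite mulrA ler_pM2r ?invr_gt0 ?exprn_gt0// /e.
rewrite mulrAC ler_pdivlMr//.
have := sqr_ge0 L; nra.
Qed.

End Rectangle.
End Goursat.

(** * The Cauchy estimate in one variable *)

Section RealRadius.
Context {R : realType} {V : normedModType R[i]}.

Lemma rnormB (x y : V) : rnorm (x - y) = rnorm (y - x).
Proof. by rewrite -rnormN opprB. Qed.

Lemma rnorm_dist_le (x y z : V) : rnorm (x - z) <= rnorm (x - y) + rnorm (y - z).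
Proof. by rewrite -[x - z](subrKA y) ler_rnormD. Qed.

Lemma ler_dist_rnorm (x y : V) : rnorm x - rnorm y <= rnorm (x - y).
Proof. by rewrite lerBlDr; have := ler_rnormD (x - y) y; rewrite subrK. Qed.

Lemma rnbhsP (x : V) (A : set V) :
  nbhs x A <-> exists2 d : R, 0 < d & forall y, rnorm (y - x) < d -> A y.
Proof.
split=> [/nbhs_ballP[e /= e0 eA]|[d d0 dA]].
  have eE : (complex.Re e)%:C = e by apply: RRe_real; exact: gtr0_real.
  exists (complex.Re e) => [|y yx]; first by rewrite -ltcR eE.
  by apply: eA; rewrite -ball_normE /ball_ /= -eE -rnormE ltcR rnormB.
apply/nbhs_ballP; exists d%:C => /=; first by rewrite ltcR.
by move=> y; rewrite -ball_normE /ball_ /= -rnormE ltcR rnormB => /dA.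
Qed.

Lemma rcvgP {T : Type} (F : set_system T) (FF : Filter F) (f : T -> V) (l : V) :
  f @ F --> l <-> forall e : R, 0 < e -> \forall x \near F, rnorm (f x - l) <= e.
Proof.
split=> [fl e e0|fl A /rnbhsP[d d0 dA]].
  by apply: (fl [set y | rnorm (y - l) <= e]); apply/rnbhsP; exists e => // y /ltW.
have d20 : 0 < d / 2 by rewrite divr_gt0.
apply: filterS (fl _ d20) => x xl; apply: dA; apply: le_lt_trans xl _; lra.
Qed.

End RealRadius.

Section ComplexModulus.
Context {R : realType}.
Implicit Types z w : R[i].

Definition cabs z : R := rnorm (z : R[i]^o).

Lemma cabsE z : cabs z = Num.sqrt (complex.Re z ^+ 2 + complex.Im z ^+ 2).
Proof. by case: z. Qed.

Lemma sqr_cabs z : cabs z ^+ 2 = complex.Re z ^+ 2 + complex.Im z ^+ 2.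
Proof. by rewrite cabsE sqr_sqrtr// addr_ge0// sqr_ge0. Qed.

Lemma normr_cabs z : `|z| = (cabs z)%:C.
Proof. exact/esym/(@rnormE _ R[i]^o). Qed.

Lemma cabs_ge0 z : 0 <= cabs z. Proof. exact: rnorm_ge0. Qed.

Lemma cabsM z w : cabs (z * w) = cabs z * cabs w.
Proof. exact: (@rnormZ _ R[i]^o). Qed.

Lemma cabs_eq0 z : (cabs z == 0) = (z == 0).
Proof.
apply/eqP/eqP => [/(@rnorm0_eq0 _ R[i]^o)//|->].
exact: (@rnorm0 _ R[i]^o).
Qed.

Lemma cabs_gt0 z : (0 < cabs z) = (z != 0).
Proof. by rewrite lt_def cabs_ge0 andbT cabs_eq0. Qed.

Lemma cabsV z : cabs z^-1 = (cabs z)^-1.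
Proof. by apply: complexI; rewrite fmorphV /= !rnormE normfV. Qed.

Lemma cabs_real (a : R) : cabs a%:C = `|a|.
Proof. by rewrite cabsE /= expr0n addr0 sqrtr_sqr. Qed.

Lemma ler_Re_cabs z : `|complex.Re z| <= cabs z.
Proof. by rewrite -sqrtr_sqr cabsE ler_wsqrtr// lerDl sqr_ge0. Qed.

Lemma ler_Im_cabs z : `|complex.Im z| <= cabs z.
Proof. by rewrite -sqrtr_sqr cabsE ler_wsqrtr// lerDr sqr_ge0. Qed.

Lemma ler_cabs_ReIm z : cabs z <= `|complex.Re z| + `|complex.Im z|.
Proof.
rewrite -(ler_pXn2r (_ : (0 < 2)%N))// ?nnegrE ?cabs_ge0 ?addr_ge0// sqr_cabs.
rewrite -[X in X + _]real_normK ?num_real// -[X in _ + X]real_normK ?num_real//.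
have := normr_ge0 (complex.Re z); have := normr_ge0 (complex.Im z); nra.
Qed.

(* A unimodular rotation carrying [z] to the positive half-line. *)
Lemma phaseP z : exists2 c : R[i], cabs c = 1 & c * z = (cabs z)%:C.
Proof.
have [->|z0] := eqVneq z 0.
  exists 1; first by rewrite -[1]/(1%:C) cabs_real normr1.
  by rewrite mulr0 /cabs (@rnorm0 _ R[i]^o).
exists ((cabs z)%:C / z); last by rewrite divfK.
by rewrite cabsM cabsV cabs_real ger0_norm ?cabs_ge0// divff ?cabs_eq0.
Qed.

End ComplexModulus.

Lemma Re_linear_part {R : realType} (A B l : R[i]) (u v : R) :
  complex.Re (A - B - l * (u +i* v))
  = complex.Re A - complex.Re B - complex.Re l * u - - complex.Im l * v.
Proof. by case: A B l => [a1 b1] [a2 b2] [a3 b3] /=; ring. Qed.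

Lemma Im_linear_part {R : realType} (A B l : R[i]) (u v : R) :
  complex.Im (A - B - l * (u +i* v))
  = - (- complex.Im A - - complex.Im B - - complex.Im l * u - - complex.Re l * v).
Proof. by case: A B l => [a1 b1] [a2 b2] [a3 b3] /=; ring. Qed.

Section ComplexDerivative.
Context {R : realType}.
Implicit Types (f g : R[i]^o -> R[i]^o) (z w : R[i]).

Lemma derivable_cabs f z : derivable f z 1 -> forall e : R, 0 < e ->
  exists2 d : R, 0 < d & forall w, cabs w < d ->
    cabs (f (z + w) - f z - 'D_1 f z * w) <= e * cabs w.
Proof.
move=> df e e0; have /rcvgP : _ --> 'D_1 f z := df.
move=> /(_ _ e0)/rnbhsP[d d0 dE]; exists d => // w wd.
have [->|w0] := eqVneq w 0.
  by rewrite mulr0 addr0 subrr subr0 /cabs (@rnorm0 _ R[i]^o) mulr0.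
have := dE w; rewrite subr0 => /(_ wd w0) /= H.
have -> : f (z + w) - f z - 'D_1 f z * w = w * (w^-1 *: (f (w *: 1 + z) - f z) - 'D_1 f z).
  rewrite mulrBr -[w^-1 *: _]/(w^-1 * _) mulVKf//.
  by rewrite -[w *: 1]/(w * 1) mulr1 (addrC w) (mulrC w).
by rewrite cabsM mulrC ler_wpM2r ?cabs_ge0.
Qed.

(** The Cauchy-Riemann equations. The conjugate field, made of [Re f] and [- Im f], has zero
    divergence, and its outward flux is the imaginary part of the contour integral of [f]. *)
Lemma derivable_pdiff f (x y : R) : derivable f (x +i* y) 1 ->
  exists p q : R,
    pdiff (fun x y => complex.Re (f (x +i* y))) x y p q /\
    pdiff (fun x y => - complex.Im (f (x +i* y))) x y q (- p).
Proof.
move=> /derivable_cabs; move: ('D_1 f _) => l df.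
exists (complex.Re l), (- complex.Im l).
have key e : 0 < e -> exists2 d, 0 < d &
    forall x' y', `|x' - x| < d -> `|y' - y| < d ->
    cabs (f (x' +i* y') - f (x +i* y) - l * ((x' - x) +i* (y' - y)))
      <= e * (`|x' - x| + `|y' - y|).
  move=> e0; have [d d0 dE] := df _ e0.
  exists (d / 2) => [|x' y' xd yd]; first by rewrite divr_gt0.
  have wE := ler_cabs_ReIm ((x' - x) +i* (y' - y)); rewrite /= in wE.
  have -> : x' +i* y' = (x +i* y) + ((x' - x) +i* (y' - y)) :> R[i].
    by apply/eqP; rewrite eq_complex /= !(addrC _ (_ - _)) !subrK !eqxx.
  apply: le_trans (dE _ _) _; first by apply: le_lt_trans wE _; lra.
  by rewrite ler_pM2l.
split=> e /key[d d0 dE]; exists d => // x' y' xd yd; apply: le_trans (dE _ _ xd yd).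
  by rewrite -Re_linear_part; exact: ler_Re_cabs.
by rewrite -normrN -Im_linear_part; exact: ler_Im_cabs.
Qed.

End ComplexDerivative.

Section CauchyEstimate.
Context {R : realType}.
Variables (f : R[i]^o -> R[i]^o) (r M : R).
Hypothesis r0 : 0 < r.
Hypothesis df : forall z, `|complex.Re z| <= r -> `|complex.Im z| <= r ->
  derivable f z 1.
Hypothesis fM : forall z, `|complex.Re z| <= r -> `|complex.Im z| <= r ->
  cabs (f z) <= M.

Let D := 'D_1 f 0.

Section Phase.
Variable c : R[i].
Hypothesis c1 : cabs c = 1.
Hypothesis cD : c * D = (cabs D)%:C.

(** Near 0 it behaves like [cabs D / z], the rotation [c] having made the residue real. The flux of
    [(P, Q)] around 0 is the imaginary part of the integral of [g], ideally 2 pi times [cabs D]. *)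
Let g (z : R[i]^o) : R[i]^o := c * (f z - f 0) * z^-1 * z^-1.
Let P (x y : R) := complex.Re (g (x +i* y)).
Let Q (x y : R) := - complex.Im (g (x +i* y)).

Let dg z : `|complex.Re z| <= r -> `|complex.Im z| <= r -> z != 0 ->
  derivable g z 1.
Proof.
move=> zr zi z0.
have dV : derivable (fun z : R[i]^o => z^-1 : R[i]^o) z 1.
  by apply: derivableV => //; exact: derivable_id.
pose h (z : R[i]^o) : R[i]^o := f z - f 0.
have dh : derivable h z 1 by apply: derivableB; [exact: df|exact: derivable_cst].
have d1 : derivable (fun z => c *: h z) z 1 by exact: derivableZ.
have d2 := @derivableM _ _ _ _ _ _ d1 dV.
exact: (@derivableM _ _ _ _ _ _ d2 dV).
Qed.

Let dPQ (x y : R) : `|x| <= r -> `|y| <= r -> x +i* y != 0 :> R[i] ->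
  exists p q s, pdiff P x y p q /\ pdiff Q x y s (- p).
Proof.
move=> xr yr z0; have [p [q [dp dq]]] := derivable_pdiff (@dg (x +i* y) xr yr z0).
by exists p, q, q.
Qed.

Let rect0 a b e d : a <= b -> e <= d -> - r <= a -> b <= r -> - r <= e -> d <= r ->
  (forall x y, a <= x <= b -> e <= y <= d -> x +i* y != 0 :> R[i]) ->
  flux P Q a b e d = 0.
Proof.
move=> ab ed ra br re dr ne; apply: goursat_flux => // x y xab yed.
by apply: dPQ; rewrite ?ler_norml; [lra|lra|exact: ne].
Qed.

Let contP x : - r <= x <= r -> x != 0 -> cont_on (- r) r (P x).
Proof.
move=> xr x0 y yr; have [|||p [q [s [/pdiff_cont[_ //]]]]] := @dPQ x y.
- by rewrite ler_norml.
- by rewrite ler_norml.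
- by rewrite eq_complex /= negb_and x0.
Qed.

Let contQ y : - r <= y <= r -> y != 0 -> cont_on (- r) r (Q^~ y).
Proof.
move=> yr y0 x xr; have [|||p [q [s [_ /pdiff_cont[//]]]]] := @dPQ x y.
- by rewrite ler_norml.
- by rewrite ler_norml.
- by rewrite eq_complex /= negb_and y0 orbT.
Qed.

(** The frame between the two squares is cut into four rectangles that avoid 0, each of zero
    flux. *)
Let flux_shrink s : 0 < s <= r -> flux P Q (- r) r (- r) r = flux P Q (- s) s (- s) s.
Proof.
move=> /andP[s0 sr].
have cP x a b : - r <= x <= r -> x != 0 -> - r <= a -> b <= r -> cont_on a b (P x).
  by move=> *; apply: cont_on_sub (contP _ _) _ _.
have cQ y a b : - r <= y <= r -> y != 0 -> - r <= a -> b <= r -> cont_on a b (Q^~ y).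
  by move=> *; apply: cont_on_sub (contQ _ _) _ _.
have rr : r != 0 by rewrite gt_eqF.
have ss : s != 0 by rewrite gt_eqF.
have Nrr : - r != 0 by rewrite oppr_eq0.
have Nss : - s != 0 by rewrite oppr_eq0.
have i1 : - r <= - r <= r by lra.
have i2 : - r <= - s <= r by lra.
have i3 : - r <= s <= r by lra.
have i4 : - r <= r <= r by lra.
have i5 : - s <= s <= r by lra.
have [/andP[j1 j2] /andP[j3 j4] /andP[j5 j6]] := And3 i2 i3 i5.
have ra : - r <= r by lra.
have ne1 x y : x != 0 -> x +i* y != 0 :> R[i] by move=> x0; rewrite eq_complex negb_and x0.
have ne2 x y : y != 0 -> x +i* y != 0 :> R[i] by move=> x0; rewrite eq_complex negb_and x0 orbT.
have pos x : s <= x <= r -> x != 0 by case/andP=> /(lt_le_trans s0) /gt_eqF ->.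
have neg x : - r <= x <= - s -> x != 0.
  case/andP=> _ xs; rewrite lt_eqF// (le_lt_trans xs)//.
  by rewrite oppr_lt0.
have Z1 : flux P Q (- r) (- s) (- r) r = 0.
  by apply: rect0 => // x y /neg x0 _; exact: ne1.
have Z2 : flux P Q s r (- r) r = 0.
  by apply: rect0 => // x y /pos x0 _; exact: ne1.
have Z3 : flux P Q (- s) s (- r) (- s) = 0.
  by apply: rect0 => // x y _ /neg y0; exact: ne2.
have Z4 : flux P Q (- s) s s r = 0.
  by apply: rect0 => // x y _ /pos y0; exact: ne2.
rewrite (@flux_cutx _ _ _ _ (- s)) ?Z1 ?add0r; [|by []|exact: cP..|exact: cQ|exact: cQ].
rewrite (@flux_cutx _ _ _ (- s) s r) ?Z2 ?addr0; [|by []|exact: cP..|exact: cQ|exact: cQ].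
rewrite (@flux_cuty _ _ _ (- s) s _ (- s)) ?Z3 ?add0r; [|by []|exact: cQ..|exact: cP|exact: cP].
rewrite (@flux_cuty _ _ _ (- s) s (- s) s) ?Z4 ?addr0; [by []|by []|exact: cQ..|exact: cP|exact: cP].
Qed.

(** The four hypotheses bound the outward normal component on the four sides, whose total length is
    [8 * s]. *)
Let fluxE_bounds s k l : 0 < s <= r ->
  (forall t, `|t| <= s -> k <= P s t <= l) -> (forall t, `|t| <= s -> k <= - P (- s) t <= l) ->
  (forall t, `|t| <= s -> k <= Q t s <= l) -> (forall t, `|t| <= s -> k <= - Q t (- s) <= l) ->
  8 * k * s <= flux P Q (- s) s (- s) s <= 8 * l * s.
Proof.
move=> /andP[s0 sr] P1 P2 Q1 Q2; rewrite /flux.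
have ss : s != 0 by rewrite gt_eqF.
have cP x : - r <= x <= r -> x != 0 -> cont_on (- s) s (P x).
  by move=> *; apply: cont_on_sub (contP _ _) _ _ => //; lra.
have cQ y : - r <= y <= r -> y != 0 -> cont_on (- s) s (Q^~ y).
  by move=> *; apply: cont_on_sub (contQ _ _) _ _ => //; lra.
have := @itvint_bounds _ (- s) s (fun y => P s y - P (- s) y) (2 * k) (2 * l).
have := @itvint_bounds _ (- s) s (fun x => Q x s - Q x (- s)) (2 * k) (2 * l).
set I1 := itvint _ _ _; set I2 := itvint _ _ _.
have -> : s - - s = 2 * s by ring.
move=> H1 H2.
have {}H1 : 2 * k * (2 * s) <= I1 <= 2 * l * (2 * s).
  apply: H1; first lra.
    by apply: cont_onB; apply: cQ; rewrite ?oppr_eq0//; lra.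
  by move=> x xs; have xs' : `|x| <= s by [rewrite ler_norml]; have := Q1 _ xs'; have := Q2 _ xs'; lra.
have {}H2 : 2 * k * (2 * s) <= I2 <= 2 * l * (2 * s).
  apply: H2; first lra.
    by apply: cont_onB; apply: cP; rewrite ?oppr_eq0//; lra.
  by move=> x xs; have xs' : `|x| <= s by [rewrite ler_norml]; have := P1 _ xs'; have := P2 _ xs'; lra.
by lra.
Qed.

(** On the boundary [cabs z] is at least [r], and [f z - f 0] has modulus at most [2 * M]. *)
Let outer : flux P Q (- r) r (- r) r <= 8 * (2 * M / r ^+ 2) * r.
Proof.
have gM z : `|complex.Re z| <= r -> `|complex.Im z| <= r ->
    r <= cabs z -> cabs (g z) <= 2 * M / r ^+ 2.
  move=> zr zi rz; have z0 : 0 < cabs z by apply: lt_le_trans rz.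
  rewrite /g !cabsM c1 mul1r cabsV -mulrA -invfM -expr2.
  apply: ler_pM; rewrite ?invr_ge0 ?exprn_ge0 ?cabs_ge0//.
  - rewrite /cabs; apply: le_trans (ler_rnormD _ _) _; rewrite rnormN mulrDl mul1r.
    by apply: lerD; apply: fM => //=; rewrite normr0 ltW.
  - rewrite lef_pV2 ?posrE ?exprn_gt0//.
    by apply: lerXn2r => //; rewrite nnegrE ltW.
have rr : `|r| <= r by rewrite gtr0_norm.
have Nrr : `|- r| <= r by rewrite normrN.
have := @fluxE_bounds r (- (2 * M / r ^+ 2)) (2 * M / r ^+ 2).
have gL x y : `|x| <= r -> `|y| <= r -> r <= Num.max `|x| `|y| ->
    `|P x y| <= 2 * M / r ^+ 2 /\ `|Q x y| <= 2 * M / r ^+ 2.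
  move=> xr yr xy; have xy' : r <= cabs (x +i* y).
    apply: le_trans xy _; rewrite ge_max.
    by rewrite (ler_Re_cabs (x +i* y)) (ler_Im_cabs (x +i* y)).
  have gz := @gM (x +i* y) xr yr xy'; rewrite /P /Q normrN; split.
    exact: le_trans (ler_Re_cabs _) gz.
  exact: le_trans (ler_Im_cabs _) gz.
rewrite r0 lexx => /(_ isT) H.
suff /andP[] : 8 * - (2 * M / r ^+ 2) * r <= flux P Q (- r) r (- r) r <= 8 * (2 * M / r ^+ 2) * r by [].
have mr t : r <= Num.max `|r| t by rewrite le_max (gtr0_norm r0) lexx.
have mNr t : r <= Num.max `|- r| t by rewrite normrN.
apply: H => t tr; rewrite -ler_norml.
- exact: (gL r t rr tr (mr _)).1.
- by rewrite (normrN (P _ _)); exact: (gL (- r) t Nrr tr (mNr _)).1.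
- by apply: (gL t r tr rr _).2; rewrite maxC.
- by rewrite (normrN (Q _ _)); apply: (gL t (- r) tr Nrr _).2; rewrite maxC.
Qed.

(** The normal component of [cabs D / z] is at least [cabs D / (2 * s)] on each side; over the
    perimeter [8 * s] this gives [4 * cabs D], a crude substitute for 2 pi times [cabs D]. The
    difference between [g] and [cabs D / z] costs [e]. *)
Let inner e : 0 < e -> exists2 s, 0 < s <= r &
  4 * cabs D - e <= flux P Q (- s) s (- s) s.
Proof.
move=> e0; have e80 : 0 < e / 8 by rewrite divr_gt0.
have df0 : derivable f 0 1 by apply: df; rewrite /= normr0 ltW.
have [d d0 dE] := derivable_cabs df0 e80.
(* On the boundary of this square [cabs z] is at most [2 * s], hence below [d]. *)
pose s := Num.min r (d / 4).
have s0 : 0 < s by rewrite lt_min r0 divr_gt0.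
have sr : s <= r by rewrite ge_min lexx.
have sd : s <= d / 4 by rewrite ge_min lexx orbT.
exists s; first by rewrite s0.
pose K := (cabs D / 2 - e / 8) / s.
have gz (z : R[i]) : 0 < cabs z -> cabs z < d -> cabs (g z - (cabs D)%:C * z^-1) <= e / 8 / cabs z.
  move=> z0 zd; have zn0 : z != 0 by rewrite -cabs_gt0.
  rewrite -cD; have -> : g z - c * D * z^-1 = c * (f z - f 0 - D * z) * z^-1 * z^-1.
    by rewrite /g; field.
  rewrite !cabsM c1 mul1r cabsV -mulrA -invfM.
  have := dE z zd; rewrite add0r => fz.
  apply: le_trans (ler_wpM2r _ fz) _; first by rewrite invr_ge0 mulr_ge0 ?ltW.
  by rewrite le_eqVlt; apply/orP; left; apply/eqP; field; rewrite gt_eqF.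
have gL x y : s <= cabs (x +i* y) -> cabs (x +i* y) < d ->
   `|P x y - cabs D * (x / (x ^+ 2 + y ^+ 2))| <= e / 8 / s /\
   `|Q x y - cabs D * (y / (x ^+ 2 + y ^+ 2))| <= e / 8 / s.
  move=> zs zd; have z0 : 0 < cabs (x +i* y) by apply: lt_le_trans zs.
  have gz' : cabs (g (x +i* y) - (cabs D)%:C * (x +i* y)^-1) <= e / 8 / s.
    apply: le_trans (gz _ z0 zd) _.
    by rewrite ler_wpM2l ?(ltW e80)// lef_pV2 ?posrE.
  split.
    apply: le_trans gz'; apply: le_trans (ler_Re_cabs _).
    rewrite le_eqVlt; apply/orP; left; apply/eqP; congr `|_|.
    by rewrite /P; case: (g _) => a b /=; rewrite mul0r subr0.
  apply: le_trans gz'; apply: le_trans (ler_Im_cabs _).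
  rewrite le_eqVlt -normrN; apply/orP; left; apply/eqP; congr `|_|.
  by rewrite /Q; case: (g _) => a b /=; ring.
have norms x y : `|x| <= s -> `|y| <= s -> s <= Num.max `|x| `|y| ->
    s <= cabs (x +i* y) /\ cabs (x +i* y) < d.
  move=> xs ys xy; split; last first.
    by apply: le_lt_trans (ler_cabs_ReIm _) _ => /=; lra.
  apply: le_trans xy _; rewrite ge_max.
  by rewrite (ler_Re_cabs (x +i* y)) (ler_Im_cabs (x +i* y)).
have ss : `|s| <= s by rewrite gtr0_norm.
have Nss : `|- s| <= s by rewrite normrN.
have half t : `|t| <= s -> (2 * s)^-1 <= s / (s ^+ 2 + t ^+ 2).
  move=> ts; have t2 : t ^+ 2 <= s ^+ 2.
    by rewrite -(real_normK (num_real t)) lerXn2r ?nnegrE// ltW.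
  have t20 := sqr_ge0 t; have s20 : 0 < s ^+ 2 by rewrite exprn_gt0.
  rewrite ler_pdivlMr ?ltr_wpDr// ler_pdivrMl ?mulr_gt0//.
  by rewrite -mulrA -expr2; lra.
have Dhalf t : `|t| <= s -> cabs D / 2 / s <= cabs D * (s / (s ^+ 2 + t ^+ 2)).
  by move=> /half ht; rewrite -mulrA -invfM ler_wpM2l ?cabs_ge0.
have KE : K = cabs D / 2 / s - e / 8 / s by rewrite /K mulrBl.
pose L := cabs D / s + e / 8 / s.
have up t : `|t| <= s -> cabs D * (s / (s ^+ 2 + t ^+ 2)) <= cabs D / s.
  move=> ts; rewrite ler_wpM2l ?cabs_ge0//.
  have t20 := sqr_ge0 t; have s20 : 0 < s ^+ 2 by rewrite exprn_gt0.
  by rewrite ler_pdivrMr ?ltr_wpDr// ler_pdivlMl// -expr2 lerDl.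
have -> : 4 * cabs D - e = 8 * K * s by rewrite /K; field; rewrite gt_eqF.
suff /andP[] : 8 * K * s <= flux P Q (- s) s (- s) s <= 8 * L * s by [].
have srr : 0 < s <= r by rewrite s0.
have ms t : s <= Num.max `|s| t by rewrite le_max (gtr0_norm s0) lexx.
have mNs t : s <= Num.max `|- s| t by rewrite normrN.
apply: fluxE_bounds => // t ts; rewrite KE /L; have := Dhalf t ts; have := up t ts.
- have [n1 n2] := norms s t ss ts (ms _).
  by have [+ _] := gL _ _ n1 n2; rewrite ler_norml; lra.
- have [n1 n2] := norms (- s) t Nss ts (mNs _).
  by have [+ _] := gL _ _ n1 n2; rewrite ler_norml sqrrN mulNr; lra.
- have ms' : s <= Num.max `|t| `|s| by rewrite maxC.
  have [n1 n2] := norms t s ts ss ms'.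
  by have [_] := gL _ _ n1 n2; rewrite ler_norml (addrC (t ^+ 2)); lra.
- have ms' : s <= Num.max `|t| `|- s| by rewrite maxC.
  have [n1 n2] := norms t (- s) ts Nss ms'.
  by have [_] := gL _ _ n1 n2; rewrite ler_norml sqrrN mulNr (addrC (t ^+ 2)); lra.
Qed.

Lemma cauchy_estimate_phase : cabs D <= 4 * M / r.
Proof.
apply/ler_addgt0Pr => e e0.
have [s sr sD] := inner e0; have := outer; rewrite (flux_shrink sr).
have -> : 8 * (2 * M / r ^+ 2) * r = 16 * M / r by field; rewrite gt_eqF.
have -> : 16 * M / r = 4 * (4 * M / r) by field; rewrite gt_eqF.
lra.
Qed.

End Phase.

Theorem cauchy_estimate : cabs ('D_1 f 0) <= 4 * M / r.
Proof. by have [c c1 cD] := phaseP D; exact: cauchy_estimate_phase c1 cD. Qed.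

End CauchyEstimate.

(** * Cauchy inequalities along directions *)

Section DirectionalDerivative.
Context {K : numFieldType} {V W : normedModType K}.
Implicit Types (f : V -> W) (a h k : V).

(** On a complex line in direction [h], derivatives in that direction become ordinary ones, so that
    one-variable estimates apply in [E]. *)
Lemma quotient_line f a h (t : K^o) :
  (fun s : K => s^-1 *: (((fun u : K^o => f (a + u *: h)) \o shift t) (s *: 1) - f (a + t *: h)))
  = (fun s => s^-1 *: ((f \o shift (a + t *: h)) (s *: h) - f (a + t *: h))).
Proof.
apply/funext => s /=; congr (_ *: (f _ - _)).
by rewrite scalerDl -[s *: 1]/(s * 1) mulr1 addrCA.
Qed.

Lemma derivable_line f a h (t : K^o) : derivable f (a + t *: h) h ->
  derivable (fun u : K^o => f (a + u *: h)) t 1.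
Proof. by rewrite /derivable quotient_line. Qed.

Lemma derive_line f a h (t : K^o) :
  'D_1 (fun u : K^o => f (a + u *: h)) t = 'D_h f (a + t *: h).
Proof. by rewrite /derive quotient_line. Qed.

Lemma quotient_shift f a h k :
  (fun s : K => s^-1 *: (((fun x => f (x + k)) \o shift a) (s *: h) - f (a + k)))
  = (fun s => s^-1 *: ((f \o shift (a + k)) (s *: h) - f (a + k))).
Proof. by apply/funext => s /=; rewrite addrA. Qed.

Lemma derivable_translate f a h k : derivable f (a + k) h ->
  derivable (fun x => f (x + k)) a h.
Proof. by rewrite /derivable quotient_shift. Qed.

Lemma derive_translate f a h k :
  'D_h (fun x => f (x + k)) a = 'D_h f (a + k).
Proof. by rewrite /derive quotient_shift. Qed.

End DirectionalDerivative.

Lemma is_derive_real {R : realType} (g : R -> R) (t l : R) :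
  (forall e, 0 < e -> exists2 d, 0 < d & forall k, `|k| < d ->
     `|g (t + k) - g t - l * k| <= e * `|k|) -> is_derive t 1 g l.
Proof.
move=> gl; have H : h^-1 *: ((g \o shift t) (h *: 1) - g t) @[h --> 0^'] --> l.
  apply/cvgrPdist_le => e e0; have [d d0 dE] := gl _ e0.
  near=> h; have hn0 : h != 0 by near: h; exact: nbhs_dnbhs_neq.
  have hd : `|h| < d by near: h; apply: dnbhs0_lt.
  have quotE : h^-1 *: ((g \o shift t) (h *: 1) - g t) - l
      = h^-1 * (g (t + h) - g t - l * h).
    by rewrite -[h *: 1]/(h * 1) mulr1 /= (addrC h t) -[_ *: _]/(_ * _); field.
  rewrite distrC quotE normrM normfV ler_pdivrMl ?normr_gt0// (mulrC `|h|).
  exact: dE.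
apply: DeriveDef; first by apply/cvg_ex; exists l.
exact: cvg_lim H.
Unshelve. all: by end_near. Qed.

Section CauchyInequalities.
Context {R : realType} {E : normedModType R[i]}.
Implicit Types (f : E -> R[i]^o) (a z h : E).

Lemma cauchy_directional f a h (rho M : R) : 0 < rho ->
  (forall w, rnorm (w - a) < rho -> derivable f w h) ->
  (forall w, rnorm (w - a) < rho -> cabs (f w) <= M) ->
  cabs ('D_h f a) <= 16 * M / rho * rnorm h.
Proof.
move=> rho0 df fM; have M0 : 0 <= M.
  by apply: le_trans (cabs_ge0 (f a)) (fM _ _); rewrite subrr rnorm0.
have [h0|h0] := eqVneq (rnorm h) 0.
  rewrite (rnorm0_eq0 h0) derive0 /cabs (@rnorm0 _ R[i]^o) mulr_ge0//.
  by rewrite divr_ge0 ?mulr_ge0// ltW.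
  exact: rnorm_ge0.
have {h0}h0 : 0 < rnorm h by rewrite lt_def h0 rnorm_ge0.
(* The square of half-side [t] lies in the disc of radius [2 * t], so [a + w *: h] stays within
   [rho / 2] of [a]; then [4 * M / t] is the announced bound. *)
pose t := rho / (4 * rnorm h); have t0 : 0 < t by rewrite divr_gt0 ?mulr_gt0.
have inball (w : R[i]) : `|complex.Re w| <= t -> `|complex.Im w| <= t ->
    rnorm (a + w *: h - a) < rho.
  move=> wr wi; rewrite addrAC subrr add0r rnormZ.
  apply: (@le_lt_trans _ _ (2 * t * rnorm h)).
    apply: ler_wpM2r; first exact: rnorm_ge0.
    by apply: le_trans (ler_cabs_ReIm w) _; lra.
  have -> : 2 * t * rnorm h = rho / 2 by rewrite /t; field; rewrite gt_eqF.
  by lra.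
have := @cauchy_estimate _ (fun u : R[i]^o => f (a + u *: h)) t M t0.
rewrite derive_line scale0r addr0.
have -> : 16 * M / rho * rnorm h = 4 * M / t.
  by rewrite /t; field; rewrite !gt_eqF.
apply=> w wr wi; last by apply: fM; exact: inball.
by apply: derivable_line; apply: df; exact: inball.
Qed.

(** Rotating the remainder onto the positive half-line makes its modulus a real part, to which the
    real mean value theorem applies. The constant [c] serves both for increments, with [c = 0], and
    for Taylor remainders. *)
Lemma complex_mean_value f a h (c : R[i]) (K : R) :
  (forall t : R, 0 <= t <= 1 -> derivable f (a + t%:C *: h) h) ->
  (forall t : R, 0 <= t <= 1 -> cabs ('D_h f (a + t%:C *: h) - c) <= K) ->
  cabs (f (a + h) - f a - c) <= K.
Proof.
move=> df dK; have [u u1 uE] := phaseP (f (a + h) - f a - c).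
pose phi (w : R[i]^o) : R[i]^o := f (a + w *: h).
pose psi (t : R) : R := complex.Re (u * (phi t%:C - t%:C * c)).
have dpsi (t : R) : 0 <= t <= 1 ->
    is_derive t 1 psi (complex.Re (u * ('D_h f (a + t%:C *: h) - c))).
  move=> t01; apply: is_derive_real => e e0.
  have dphi : derivable phi t%:C 1 by apply: derivable_line; exact: df.
  have [d d0 dE] := derivable_cabs dphi e0; exists d => // k kd.
  have := dE k%:C; rewrite cabs_real => /(_ kd).
  rewrite derive_line -[X in X <= _]mul1r -u1 -cabsM; apply: le_trans.
  apply: le_trans (ler_Re_cabs _).
  rewrite le_eqVlt; apply/orP; left; apply/eqP; congr `|_|.
  rewrite /psi -rmorphD /=.
  move: (phi _) (phi _) ('D_h _ _) => p1 p2 p3.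
  case: u c p1 p2 p3 {u1 uE dK psi dE} => [u1 u2] [c1 c2] [p1 q1] [p2 q2] [p3 q3] /=; ring.
have cpsi : {within `[0, 1], continuous psi}.
  apply: continuous_in_subspaceT => t; rewrite inE /= in_itv /= => t01.
  have [dp _] := dpsi t t01.
  exact/differentiable_continuous/derivable1_diffP.
have dpsi' (t : R) : t \in `]0, 1[ ->
    is_derive t 1 psi (complex.Re (u * ('D_h f (a + t%:C *: h) - c))).
  by rewrite in_itv /= => /andP[/ltW ? /ltW ?]; apply: dpsi; apply/andP.
have [t t01] := MVT_segment (ler01 : 0 <= 1 :> R) dpsi' cpsi.
rewrite subr0 mulr1 /psi /phi scale1r scale0r addr0 mul1r mul0r subr0.
have -> : complex.Re (u * (f (a + h) - c)) - complex.Re (u * f a) = cabs (f (a + h) - f a - c).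
  have -> : cabs (f (a + h) - f a - c) = complex.Re (u * (f (a + h) - f a - c)) by rewrite uE.
  case: (f (a + h)) (f a) (u) (c) => [u1' u2] [c1 c2] [p1 q1] [p2 q2] /=; ring.
move=> ->; apply: le_trans (ler_norm _) _; apply: le_trans (ler_Re_cabs _) _.
rewrite cabsM u1 mul1r; apply: dK; move: t01; by rewrite in_itv.
Qed.

(* The increments [f (. + h) - f] are holomorphic and [O(|h|)], so the Cauchy
   inequality applied to them makes the derivative of [f] Lipschitz. *)
Lemma taylor2_bound f z (r M : R) : 0 < r ->
  (forall w h, rnorm (w - z) < r -> derivable f w h) ->
  (forall w, rnorm (w - z) < r -> cabs (f w) <= M) ->
  forall h, rnorm h < r / 4 ->
    cabs (f (z + h) - f z - 'D_h f z) <= 2048 * M / r ^+ 2 * rnorm h ^+ 2.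
Proof.
move=> r0 df fM h hr.
have M0 : 0 <= M.
  by apply: le_trans (cabs_ge0 (f z)) (fM _ _); rewrite subrr rnorm0.
have dbound a k : rnorm (a - z) < r / 2 -> cabs ('D_k f a) <= 32 * M / r * rnorm k.
  move=> az; have -> : 32 * M / r = 16 * M / (r / 2) by field; rewrite gt_eqF.
  have sub w : rnorm (w - a) < r / 2 -> rnorm (w - z) < r.
    by move=> wa; apply: le_lt_trans (rnorm_dist_le w a z) _; lra.
  apply: cauchy_directional => [|w /sub|w /sub]; first by rewrite divr_gt0.
    exact: df.
  exact: fM.
have lip a k : rnorm (a - z) < r / 4 -> rnorm k < r / 4 ->
    cabs (f (a + k) - f a) <= 32 * M / r * rnorm k.
  move=> az kr; rewrite -[_ - _]subr0.
  have sub (t : R) : 0 <= t <= 1 -> rnorm (a + t%:C *: k - z) < r / 2.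
    move=> /andP[t0 t1]; rewrite addrAC; apply: le_lt_trans (ler_rnormD _ _) _.
    rewrite rnormZ rnorm_real//.
    have := rnorm_ge0 k; nra.
  apply: complex_mean_value => t /sub az'; rewrite ?subr0; last exact: dbound.
  by apply: df; lra.
apply: complex_mean_value => t /andP[t0 t1].
  apply: df; rewrite addrAC subrr add0r rnormZ rnorm_real//.
  have := rnorm_ge0 h; nra.
have thr : rnorm (t%:C *: h) <= rnorm h.
  by rewrite rnormZ rnorm_real//; have := rnorm_ge0 h; nra.
have dfr w : rnorm (w - z) < r / 4 ->
    derivable f w h /\ derivable f (w + t%:C *: h) h.
  move=> wz; split; apply: df; first by lra.
  by rewrite addrAC; apply: le_lt_trans (ler_rnormD _ _) _; lra.
pose g x : R[i]^o := f (x + t%:C *: h).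
have dg w : rnorm (w - z) < r / 4 -> derivable g w h.
  by move=> /dfr[_ d2]; exact: derivable_translate.
have dt w : rnorm (w - z) < r / 4 -> derivable (g - f) w h.
  by move=> wz; apply: (derivableB (dg w wz)); case: (dfr w wz).
have zz : rnorm (z - z) < r / 4 by rewrite subrr rnorm0 divr_gt0.
have [dz1 dz2] := dfr z zz.
have -> : 'D_h f (z + t%:C *: h) - 'D_h f z = 'D_h (g - f) z.
  by rewrite (deriveB (dg z zz) dz1) /g derive_translate.
have r40 : 0 < r / 4 by rewrite divr_gt0.
(* On this ball [g - f] is bounded by [32 * M / r * rnorm h]; the Cauchy inequality multiplies the
   bound by [16 / (r / 4)] and by [rnorm h], whence 2048. *)
have := @cauchy_directional (g - f) z h (r / 4)
  (32 * M / r * rnorm h) r40 dt.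
have -> : 16 * (32 * M / r * rnorm h) / (r / 4) * rnorm h
    = 2048 * M / r ^+ 2 * rnorm h ^+ 2 by field; rewrite gt_eqF.
apply=> w wz; apply: le_trans (lip _ _ wz _) _; first exact: le_lt_trans hr.
by apply: ler_wpM2l => //; rewrite divr_ge0 ?mulr_ge0// ltW.
Qed.

End CauchyInequalities.

(** * Completeness of the predual and differentiability of the evaluation map *)

Lemma linear_packP {K : pzRingType} {V W : lmodType K} (f : V -> W) :
  linear f -> exists g : {linear V -> W}, g =1 f.
Proof.
move=> lf; pose g : {linear V -> W} := HB.pack f (GRing.isLinear.Build K V W _ f lf).
by exists g.
Qed.

Section CauchySequences.
Context {R : realType}.

Definition cauchy_rnorm {V : normedModType R[i]} (u : nat -> V) :=
  forall e : R, 0 < e -> exists N, forall n, (N <= n)%N -> rnorm (u n - u N) <= e.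

Lemma cvg_rnormP {V : normedModType R[i]} (u : nat -> V) (l : V) :
  u @ \oo --> l <->
  forall e : R, 0 < e -> exists N, forall n, (N <= n)%N -> rnorm (u n - l) <= e.
Proof.
split=> [/rcvgP ul e /ul [N _ NP]|ul]; first by exists N => n Nn; exact: NP.
by apply/rcvgP => e /ul[N NP]; exists N.
Qed.

Lemma cvg_axpy {V : normedModType R[i]} a (u w : nat -> V) (l m : V) :
  u @ \oo --> l -> w @ \oo --> m -> (fun n => a *: u n + w n) @ \oo --> a *: l + m.
Proof.
move=> ul wm; apply: cvgD => //.
exact: (cvgZl_tmp (k := a) ul).
Qed.

Lemma cvg_seq_unique {V : normedModType R[i]} (u : nat -> V) (l m : V) :
  u @ \oo --> l -> u @ \oo --> m -> l = m.
Proof. by apply: cvg_unique; exact: norm_hausdorff. Qed.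

Lemma cauchy_rnorm_cvg {V : completeNormedModType R[i]} (u : nat -> V) :
  cauchy_rnorm u -> cvg (u @ \oo).
Proof.
move=> cu; apply/cauchy_cvgP/cauchy_exP => e e0.
have eE : (complex.Re e)%:C = e by apply: RRe_real; exact: gtr0_real.
have e20 : 0 < complex.Re e / 2 by rewrite divr_gt0// -ltcR eE.
have [N NP] := cu _ e20; exists (u N), N => // n /= Nn.
rewrite -ball_normE /ball_ /= -rnormE -eE ltcR rnormB.
apply: le_lt_trans (NP n Nn) _; lra.
Qed.

Lemma cauchy_complex_cvg (u : nat -> R[i]^o) :
  cauchy_rnorm u -> cvg (u @ \oo).
Proof.
move=> cu.
have cr (p : R[i] -> R) : (forall z w, `|p z - p w| <= cabs (z - w)) ->
    exists l, forall e, 0 < e -> exists N, forall n, (N <= n)%N -> `|p (u n) - l| <= e.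
  move=> pL; have /cvg_ex[l /cvgrPdist_le pl] : cvg (p (u n) @[n --> \oo]).
    apply/cauchy_cvgP/cauchy_exP => e e0.
    have e20 : 0 < e / 2 by rewrite divr_gt0.
    have [N NP] := cu _ e20; exists (p (u N)), N => // n /= Nn.
    rewrite /ball /= distrC; apply: le_lt_trans (pL _ _) _.
    by apply: le_lt_trans (NP n Nn) _; lra.
  exists l => e /pl[N _ NP]; exists N => n Nn; rewrite distrC; exact: NP.
have [|a aP] := cr (@complex.Re R).
  by move=> z w; apply: le_trans (ler_Re_cabs _); case: z w => [? ?] [? ?].
have [|b bP] := cr (@complex.Im R).
  by move=> z w; apply: le_trans (ler_Im_cabs _); case: z w => [? ?] [? ?].
apply/cvg_ex; exists (a +i* b); apply/cvg_rnormP => e e0.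
have e20 : 0 < e / 2 by rewrite divr_gt0.
have [N1 P1] := aP _ e20; have [N2 P2] := bP _ e20.
exists (maxn N1 N2) => n; rewrite geq_max => /andP[/P1 + /P2].
have := ler_cabs_ReIm (u n - (a +i* b)); rewrite /cabs.
case: (u n) => x y /=; lra.
Qed.

End CauchySequences.

Section Differentiability.
Context {R : realType} {V W : normedModType R[i]}.

Lemma differentiable_quadratic (f : V -> W) (x : V) (df : {linear V -> W}) (C d : R) :
  continuous df -> 0 < d ->
  (forall h, rnorm h < d -> rnorm (f (x + h) - f x - df h) <= C * rnorm h ^+ 2) ->
  differentiable f x.
Proof.
move=> cdf d0 fC.
have fE : f \o shift x = cst (f x) + df +o_ 0 id.
  apply/eqaddoP => e e0.
  have eE : (complex.Re e)%:C = e by apply: RRe_real; exact: gtr0_real.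
  have re0 : 0 < complex.Re e by rewrite -ltcR eE.
  have C0 : 0 < `|C| + 1 by rewrite ltr_wpDl.
  apply/rnbhsP; exists (Num.min d (complex.Re e / (`|C| + 1))).
    by rewrite lt_min d0 divr_gt0.
  move=> h; rewrite subr0 lt_min => /andP[hd he].
  rewrite -!rnormE -eE -rmorphM /= lecR.
  have -> : (f \o shift x - (cst (f x) + df)) h = f (x + h) - f x - df h.
    by rewrite -addrA -opprD (addrC x).
  apply: le_trans (fC h hd) _; rewrite expr2 mulrA.
  apply: ler_wpM2r; first exact: rnorm_ge0.
  have h0 := rnorm_ge0 h.
  apply: (@le_trans _ _ ((`|C| + 1) * rnorm h)).
    by apply: ler_wpM2r => //; have := ler_norm C; lra.
  by rewrite mulrC -ler_pdivlMr// ltW.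
by apply/diff_locallyP; rewrite (diff_unique cdf fE).
Qed.

Lemma bounded_rnorm_continuous (f : {linear V -> W}) (C : R) :
  (forall x, rnorm (f x) <= C * rnorm x) -> continuous f.
Proof.
move=> fC; apply/linear_bounded_continuous/linear_boundedP.
near=> k => x; rewrite -!rnormE.
have : C%:C <= k by near: k; apply: nbhs_pinfty_ge; apply/complex_realP; exists C.
move=> Ck; apply: le_trans (_ : (C * rnorm x)%:C <= _); first by rewrite lecR.
by rewrite rmorphM /= ler_wpM2r// ler0c rnorm_ge0.
Unshelve. all: by end_near. Qed.

End Differentiability.

Lemma derive_dirZ {K : numFieldType} {V W : normedModType K} (f : V -> W) x a h :
  differentiable f x -> 'D_(a *: h) f x = a *: 'D_h f x.
Proof. by move=> df; rewrite !deriveE// linearZ. Qed.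

Lemma scale_real_invK {R : realType} {V : lmodType R[i]} (t : R) (x : V) : t != 0 ->
  (t^-1)%:C *: (t%:C *: x) = x.
Proof. by move=> t0; rewrite scalerA -rmorphM /= mulVf// scale1r. Qed.

Lemma derive_axpy {K : numFieldType} {V W : normedModType K} a (f g : V -> W) x h :
  derivable f x h -> derivable g x h ->
  'D_h (a *: f + g) x = a *: 'D_h f x + 'D_h g x.
Proof. by move=> df dg; rewrite deriveD ?deriveZ//; exact: derivableZ. Qed.

Lemma Hinf_fun_axpy {R : realType} {E : normedModType R[i]} {U : set E}
    {v : weight U} {F : normedModType R[i]} a (f g : Hinf v F) :
  Hinf_fun (a *: f + g) = a *: (f : E -> F) + (g : E -> F).
Proof. by []. Qed.

Section PredualComplete.
Context {R : realType} {E : normedModType R[i]} {U : set E} (v : weight U).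
Local Notation H := (Hinf v R[i]^o).
Local Notation G := (Ginf v).

Lemma rnorm_Ginf (phi : G) : rnorm phi = opnorm phi.
Proof. by []. Qed.

Lemma Ginf_ub (phi : G) (f : H) : rnorm (phi f) <= rnorm phi * rnorm f.
Proof.
have [f0|f0] := eqVneq (rnorm f) 0.
  by rewrite (rnorm0_eq0 f0) -(scale0r (0 : H)) Ginf_scalable !scale0r !rnorm0 mulr0.
have {f0}f0 : 0 < rnorm f by rewrite lt_def f0 rnorm_ge0.
have := @opnorm_ub _ _ phi ((rnorm f)^-1%:C *: f) (Ginf_bounded phi).
rewrite Ginf_scalable !rnormZ rnorm_real ?invr_ge0 ?rnorm_ge0// mulVf ?gt_eqF//.
by move=> /(_ (lexx _)); rewrite ler_pdivrMl// mulrC.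
Qed.

Lemma Ginf_le (phi : G) (M : R) :
  (forall f : H, rnorm f <= 1 -> rnorm (phi f) <= M) -> rnorm phi <= M.
Proof. by move=> ?; rewrite rnorm_Ginf; exact: opnorm_le. Qed.

(** Uniform approximation on the unit ball preserves continuity there for the compact-open topology.
    This places in the predual two kinds of limits: those of Cauchy sequences and the directional
    derivatives of the evaluation. *)
Lemma Ginf_uniform_limit (psi : nat -> G) (L : H -> R[i]^o) : linear L ->
  (forall e : R, 0 < e -> exists n, forall f : H, rnorm f <= 1 ->
     rnorm (psi n f - L f) <= e) ->
  exists phi : G, forall f, phi f = L f.
Proof.
move=> lL psiL; suff LG : L \in @Ginf_pred _ _ _ v by exists (MkGinf LG).
apply/mem_set; split => // x.
have [x1|x1] := pselect ((closed_unit_ball H : set (Hinf_co v)) x); last first.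
  (* Outside the ball the subspace topology is discrete, so continuity matters only at points of the
     ball. *)
  move=> A /= LA; rewrite /nbhs /= -nbhs_subspace_out//.
  by move=> _ ->; exact: nbhs_singleton LA.
apply/rcvgP => e e0; have e30 : 0 < e / 3 by rewrite divr_gt0.
have [n nP] := psiL _ e30.
pose B : set (Hinf_co v) := closed_unit_ball H.
have nB : nbhs (x : subspace B) B.
  by rewrite /nbhs /= -nbhs_subspace_in//; exact: withinT.
have /rcvgP /(_ _ e30) := @Ginf_continuous _ _ _ _ (psi n) x.
apply: filterS2 nB => y y1 yP.
apply: le_trans (rnorm_dist_le _ (psi n y) _) _.
rewrite rnormB; have := nP y y1.
have := rnorm_dist_le (psi n y) (psi n x) (L x); have := nP x x1; lra.
Qed.

Lemma Ginf_complete (psi : nat -> G) : cauchy_rnorm psi ->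
  exists phi : G, psi @ \oo --> phi.
Proof.
move=> cpsi.
have pt (f : H) : exists l : R[i]^o, psi n f @[n --> \oo] --> l.
  apply/cvg_ex; apply: cauchy_complex_cvg => e e0.
  have f0 := rnorm_ge0 f; have f1 : 0 < rnorm f + 1 by lra.
  have [N NP] := cpsi _ (divr_gt0 e0 f1); exists N => n Nn.
  apply: le_trans (Ginf_ub (psi n - psi N) f) _.
  apply: (@le_trans _ _ (e / (rnorm f + 1) * rnorm f)).
    by apply: ler_wpM2r => //; exact: NP.
  by rewrite mulrAC ler_pdivrMr// ler_wpM2l ?(ltW e0)//; lra.
have [L LP] := choice pt.
have LL : linear L.
  move=> a f g; have H1 := LP (a *: f + g).
  have H2 : psi n (a *: f + g) @[n --> \oo] --> a *: L f + L g.
    rewrite (_ : (fun n => _) = (fun n => a *: psi n f + psi n g)); last first.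
      by apply/funext => n; rewrite Ginf_linear.
    exact: (cvg_axpy (a := a) (LP f) (LP g)).
  exact: (cvg_seq_unique H1 H2).
have unif (e : R) : 0 < e -> exists N, forall n, (N <= n)%N -> forall f : H, rnorm f <= 1 ->
    rnorm (psi n f - L f) <= e.
  move=> e0; have e20 : 0 < e / 2 by rewrite divr_gt0.
  have [N NP] := cpsi _ e20; exists N => n Nn f f1.
  apply/ler_addgt0Pr => d d0; have /cvg_rnormP /(_ _ d0)[m mP] := LP f.
  have := mP (maxn m N) (leq_maxl _ _); set k := maxn m N => kL.
  have Nk : (N <= k)%N by exact: leq_maxr.
  have dist j : (N <= j)%N -> rnorm (psi j f - psi N f) <= e / 2.
    move=> /NP Nj; apply: le_trans (Ginf_ub (psi j - psi N) f) _.
    by rewrite -[leRHS]mulr1; apply: ler_pM; rewrite ?rnorm_ge0.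
  have := rnorm_dist_le (psi n f) (psi k f) (L f).
  have := rnorm_dist_le (psi n f) (psi N f) (psi k f); rewrite [X in _ <= _ + X -> _]rnormB.
  have := dist _ Nn; have := dist _ Nk; lra.
have [|phi phiE] := @Ginf_uniform_limit psi L LL.
  by move=> e /unif[N NP]; exists N => f; exact: NP.
exists phi; apply/cvg_rnormP => e /unif[N NP]; exists N => n /NP nP.
by apply: Ginf_le => f f1; have := nP f f1; rewrite -phiE.
Qed.

Hypothesis openU : open U.

(** Near [z] the weight stays above [v z / 2], so [2 / v z] bounds the whole unit ball there; this
    makes the Taylor remainders uniform over that ball. *)
Lemma weight_local_bound z : U z -> exists2 r : R, 0 < r &
  exists2 M : R, 0 < M & forall w, rnorm (w - z) < r -> U w /\
    forall f : H, rnorm f <= 1 -> cabs (f w) <= M.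
Proof.
move=> Uz; have vz := weight_gt0 v Uz.
have cv : {for z, continuous v}.
  have := @weight_continuous _ _ _ v; rewrite continuous_open_subspace//.
  by apply; rewrite inE.
have : \forall w \near z, U w /\ v z / 2 < v w.
  near=> w; split; first by near: w; exact: open_nbhs_nbhs.
  near: w; apply: (cvgr_gt (v z) cv); lra.
move=> /rnbhsP[r r0 rP]; exists r => //; exists (2 / v z); first by rewrite divr_gt0.
move=> w /rP[Uw vw]; split=> // f f1.
have vw0 : 0 < v w by apply: lt_trans vw; rewrite divr_gt0.
have := le_trans (Hinf_norm_ub f Uw) f1.
rewrite -[rnorm (f w)]/(cabs (f w)) mulrC -ler_pdivlMr// => /le_trans; apply.
rewrite -[2 / v z]invf_div div1r lef_pV2 ?posrE//; first exact: ltW.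
by rewrite divr_gt0.
Unshelve. all: by end_near. Qed.

Lemma delta_differentiable z : U z -> differentiable (delta v) z.
Proof.
move=> Uz; have [r r0 [M M0 rP]] := weight_local_bound Uz.
have Hd (f : H) w : U w -> differentiable f w.
  by move=> Uw; have /set_mem[df _ _] := Hinf_mem f; exact: df.
have Hder (f : H) w h : rnorm (w - z) < r -> derivable f w h.
  by move=> /rP[Uw _]; apply: diff_derivable; exact: Hd.
have r40 : 0 < r / 4 by rewrite divr_gt0.
have [C C0 tay] : exists2 C : R, 0 <= C & forall (f : H) h,
    rnorm f <= 1 -> rnorm h < r / 4 ->
    rnorm (f (z + h) - f z - 'D_h f z) <= C * rnorm h ^+ 2.
  exists (2048 * M / r ^+ 2) => [|f h f1 hr].
    apply: divr_ge0; last exact/ltW/exprn_gt0.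
    by apply: mulr_ge0; [exact: ler0n|exact: ltW].
  apply: (taylor2_bound r0) => // [w k|w wz]; first exact: Hder.
  by have [_] := rP w wz; apply.
(* The derivative in direction [h] is a limit, uniform on the unit ball, of difference quotients of
   [delta], hence lies in the predual. *)
have DP h : exists D : G, forall f : H, D f = 'D_h f z.
  (* The denominator [rnorm h + 1] covers [h = 0] and keeps every increment inside radius
     [r / 4]. *)
  pose t n : R := (r / 4 / (rnorm h + 1)) / n.+1%:R.
  have h0 := rnorm_ge0 h; have h1 : 0 < rnorm h + 1 by lra.
  have t0 n : 0 < t n by rewrite !divr_gt0.
  have th n : rnorm ((t n)%:C *: h) < r / 4.
    rewrite rnormZ rnorm_real ?(ltW (t0 n))//.
    apply: (@le_lt_trans _ _ (r / 4 / (rnorm h + 1) * rnorm h)).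
      apply: ler_wpM2r => //; rewrite ler_pdivrMr ?ltr0n//.
      by rewrite ler_peMr ?ler1n// ltW// divr_gt0.
    by rewrite mulrAC ltr_pdivrMr// ltr_pM2l//; lra.
  apply: (@Ginf_uniform_limit (fun n => ((t n)^-1)%:C *: (delta v (z + (t n)%:C *: h) - delta v z))
    (fun f : H => 'D_h (f : E -> R[i]^o) z)).
    move=> a f g; have zz : rnorm (z - z) < r by rewrite subrr rnorm0.
    have df := Hder f z h zz; have dg := Hder g z h zz.
    rewrite Hinf_fun_axpy.
    exact: derive_axpy df dg.
  move=> e e0; pose K := C * rnorm h ^+ 2 * (r / 4 / (rnorm h + 1)).
  have K0 : 0 <= K by rewrite !mulr_ge0 ?exprn_ge0 ?invr_ge0 ?(ltW h1) ?(ltW r0).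
  exists (Num.bound (K / e)) => f f1; set n := Num.bound _.
  have -> : (((t n)^-1)%:C *: (delta v (z + (t n)%:C *: h) - delta v z)) f - 'D_h f z
    = ((t n)^-1)%:C *: (f (z + (t n)%:C *: h) - f z - 'D_((t n)%:C *: h) f z).
    rewrite [X in X - _]/(((t n)^-1)%:C *: (f (z + (t n)%:C *: h) - f z)) [RHS]scalerBr.
    congr (_ - _); rewrite (derive_dirZ _ _ (Hd f z Uz)).
    by rewrite scale_real_invK// gt_eqF.
  rewrite rnormZ rnorm_real ?invr_ge0 ?(ltW (t0 n))//.
  apply: le_trans (ler_wpM2l _ (tay f _ f1 (th n))) _; first by rewrite invr_ge0 ltW.
  rewrite rnormZ rnorm_real ?(ltW (t0 n))//.
  have -> : (t n)^-1 * (C * (t n * rnorm h) ^+ 2) = K / n.+1%:R.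
    by rewrite /K /t; field; rewrite !gt_eqF//= pnatr_eq0.
  rewrite ler_pdivrMr ?ltr0n// mulrC -ler_pdivrMr//.
  apply: ltW; apply: lt_trans (archi_boundP (divr_ge0 K0 (ltW e0))) _.
  by rewrite ltr_nat.
have [D DE] := choice DP.
have lD : linear D.
  move=> a h k; apply: val_inj; apply/funext => f.
  rewrite [RHS]/(a *: D h f + D k f) [LHS]DE !DE !(deriveE _ (Hd f z Uz)).
  by rewrite linearP.
have [Dl DlE] := linear_packP lD.
apply: (@differentiable_quadratic _ _ _ (delta v) z Dl C (r / 4)) => //.
  apply: (@bounded_rnorm_continuous _ _ _ _ (16 * M / r)) => h; rewrite DlE.
  apply: Ginf_le => f f1; rewrite DE.
  apply: cauchy_directional => // w wz; first exact: Hder.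
  by have [_] := rP w wz; apply.
move=> h hr; apply: Ginf_le => f f1; rewrite DlE.
rewrite [X in rnorm X](_ : _ = f (z + h) - f z - D h f)// DE.
exact: tay.
Qed.

End PredualComplete.

(** * Norming functionals *)

Section HahnBanach.
Context {R : realType} {V : lmodType R[i]}.
Implicit Types (p q : V -> R) (x y : V) (t s : R).

Definition sublinear p :=
  (forall x y, p (x + y) <= p x + p y) /\
  (forall t x, 0 <= t -> p (t%:C *: x) <= t * p x).

Lemma sublinear0 p : sublinear p -> p 0 = 0.
Proof.
move=> [pD pZ]; have := pD 0 0; have := pZ 0 0 (lexx _).
rewrite scale0r addr0; lra.
Qed.

Lemma sublinear_geN p x : sublinear p -> - p (- x) <= p x.
Proof. by move=> sp; have [pD _] := sp; have := pD x (- x); rewrite subrr sublinear0//; lra. Qed.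

Lemma sublinearZ p t x : sublinear p -> 0 <= t -> p (t%:C *: x) = t * p x.
Proof.
move=> sp; have [_ pZ] := sp; rewrite le_eqVlt => /predU1P[<-|t0].
  by rewrite scale0r mul0r sublinear0.
apply/eqP; rewrite eq_le pZ ?(ltW t0)//= -ler_pdivlMl//.
have ti : 0 <= t^-1 by rewrite invr_ge0 ltW.
by have := pZ t^-1 (t%:C *: x) ti; rewrite scale_real_invK// gt_eqF.
Qed.

(** A sublinear functional below [p] whose value at [- x0] is at most [- p x0]. It serves in the
    minimality argument, and again at the end: any linear minorant of the descent of the norm at
    [x0] attains [rnorm x0] at [x0]. *)
Definition descent p x0 x : R := inf [set p (x + t%:C *: x0) - t * p x0 | t in [set t | 0 <= t]].

Section Descent.
Variables (p : V -> R) (x0 : V).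
Hypothesis sp : sublinear p.

Lemma descent_le t x : 0 <= t -> descent p x0 x <= p (x + t%:C *: x0) - t * p x0.
Proof.
move=> t0; apply: ge_inf; last by exists t.
exists (- p (- x)) => _ [s /= s0 <-]; rewrite -sublinearZ//.
by have [pD _] := sp; have := pD (x + s%:C *: x0) (- x); rewrite addrAC subrr add0r; lra.
Qed.

Lemma descent_ge x M : (forall t, 0 <= t -> M <= p (x + t%:C *: x0) - t * p x0) ->
  M <= descent p x0 x.
Proof.
move=> H; apply: lb_le_inf; last by move=> _ [t /= t0 <-]; exact: H.
by exists (p (x + 0%:C *: x0) - 0 * p x0), 0 => //=.
Qed.

Lemma descent_lep x : descent p x0 x <= p x.
Proof. by have := descent_le x (lexx 0); rewrite scale0r addr0 mul0r subr0. Qed.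

Lemma descent_le1 x : descent p x0 x <= p (x + x0) - p x0.
Proof. by have := descent_le x ler01; rewrite scale1r mul1r. Qed.

Lemma descent_sublinear : sublinear (descent p x0).
Proof.
split=> [x y|t x].
  rewrite -lerBlDl; apply: descent_ge => t t0.
  rewrite lerBlDl -lerBlDr; apply: descent_ge => s s0.
  rewrite lerBlDr; apply: le_trans (descent_le (x + y) (addr_ge0 t0 s0)) _.
  have [pD _] := sp; have := pD (x + s%:C *: x0) (y + t%:C *: x0).
  by rewrite addrACA -scalerDl -rmorphD /= (addrC s t); lra.
rewrite le_eqVlt => /predU1P[<-|t0].
  by rewrite scale0r mul0r -(sublinear0 sp) descent_lep.
rewrite -ler_pdivrMl//; apply: descent_ge => s s0; rewrite ler_pdivrMl//.
apply: le_trans (descent_le _ (mulr_ge0 (ltW t0) s0)) _.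
rewrite rmorphM /= -scalerA -scalerDr sublinearZ ?(ltW t0)//.
by rewrite mulrBr mulrA.
Qed.

End Descent.

(* A minimal sublinear functional [q] equals each of its descents, so that
   [q x <= q (x + y) - q y]: it is additive. *)
Lemma linear_minorant p0 : sublinear p0 -> exists q,
  [/\ forall x, q x <= p0 x, forall x y, q (x + y) = q x + q y &
      forall t x, q (t%:C *: x) = t * q x].
Proof.
move=> sp0; pose T := {p : V -> R | sublinear p /\ forall x, p x <= p0 x}.
(* The order is reversed, so that a maximal element in the sense of Zorn is a minimal functional. *)
pose r (p q : T) := `[< forall x, sval q x <= sval p x >].
have [|||A Atot|[q [sq qp0]] qmin] := @Zorn T r.
- by move=> p; apply/asboolP.
- by move=> p q s /asboolP pq /asboolP qs; apply/asboolP => x; exact: le_trans (pq x).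
- move=> [p sp] [q sq] /asboolP pq /asboolP qp; apply: eq_exist; apply/funext => x.
  by apply/eqP; rewrite eq_le pq qp.
- have [[a0 Aa0]|A0] := pselect (A !=set0); last first.
    by exists (exist _ p0 (conj sp0 (fun=> lexx _))) => s As; case: A0; exists s.
  (* The infimum is finite because every member of the chain is at least [- p0 (- x)]; it is
     subadditive because any two members are comparable. *)
  pose q x := inf [set sval p x | p in A].
  have lbA x : has_lbound [set sval p x | p in A].
    exists (- p0 (- x)) => _ [[p [sp pp0]] _ <-] /=.
    by apply: le_trans (sublinear_geN _ sp); rewrite lerN2.
  have qle (p : T) x : A p -> q x <= sval p x by move=> Ap; apply: ge_inf => //; exists p.
  have qge x M : (forall p : T, A p -> M <= sval p x) -> M <= q x.
    move=> H; apply: lb_le_inf; first by exists (sval a0 x), a0.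
    by move=> _ [p Ap <-]; exact: H.
  have sq : sublinear q.
    split=> [x y|t x].
      rewrite -lerBlDl; apply: (@qge) => p Ap.
      rewrite lerBlDl -lerBlDr; apply: (@qge) => p' Ap'; rewrite lerBlDr.
      have [/asboolP pp|/asboolP pp] := Atot _ _ Ap Ap'.
        apply: le_trans (qle _ _ Ap') _.
        by have [[pD _] _] := svalP p'; have := pD x y; have := pp y; lra.
      apply: le_trans (qle _ _ Ap) _.
      by have [[pD _] _] := svalP p; have := pD x y; have := pp x; lra.
    rewrite le_eqVlt => /predU1P[<-|t0].
      rewrite scale0r mul0r; apply: le_trans (qle _ _ Aa0) _.
      by have [sa _] := svalP a0; rewrite sublinear0.
    rewrite -ler_pdivrMl//; apply: (@qge) => p Ap; rewrite ler_pdivrMl//.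
    have [sp _] := svalP p; rewrite -sublinearZ ?(ltW t0)//; exact: qle.
  have qp0 x : q x <= p0 x.
    by apply: le_trans (qle _ _ Aa0) _; have [_] := svalP a0.
  exists (exist _ q (conj sq qp0)) => p Ap; apply/asboolP => x /=; exact: qle.
have qD x y : q (x + y) = q x + q y.
  apply/eqP; rewrite eq_le; have [-> _] := sq; rewrite /= -lerBrDr.
  have dp0 z : descent q y z <= p0 z.
    by apply: le_trans (descent_lep _ sq _) (qp0 z).
  have rq : r (exist _ q (conj sq qp0)) (exist _ (descent q y) (conj (descent_sublinear y sq) dp0)).
    by apply/asboolP => z; exact: descent_lep.
  have /(congr1 sval) /= dq := qmin _ rq.
  by have := descent_le1 y sq x; rewrite dq.
have qN x : q (- x) = - q x.
  by apply/eqP; rewrite -addr_eq0 -qD addNr sublinear0.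
exists q; split => // t x; have [t0|t0] := leP 0 t; first exact: sublinearZ.
have Nt0 : 0 <= - t by rewrite oppr_ge0 ltW.
have := sublinearZ x sq Nt0; rewrite rmorphN /= scaleNr qN; lra.
Qed.

End HahnBanach.

Section NormingFunctional.
Context {R : realType} {V : normedModType R[i]}.

Lemma rnorm_sublinear : sublinear (@rnorm R V).
Proof.
split=> [x y|t x t0]; first exact: ler_rnormD.
by rewrite rnormZ rnorm_real.
Qed.

Lemma norming_functional (x0 : V) : exists phi : {linear V -> R[i]^o},
  [/\ continuous phi, forall x, rnorm (phi x) <= rnorm x & rnorm (phi x0) = rnorm x0].
Proof.
have [q [qle qD qZ]] := linear_minorant (descent_sublinear x0 rnorm_sublinear).
have qn x : q x <= rnorm x.
  exact: le_trans (qle x) (descent_lep _ rnorm_sublinear x).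
have q0 : q 0 = 0 by rewrite -(scale0r (0 : V)) -[0 *: _]/(0%:C *: 0) qZ mul0r.
have qN x : q (- x) = - q x by apply/eqP; rewrite -addr_eq0 -qD addNr q0.
have qx0 : q x0 = rnorm x0.
  apply/eqP; rewrite eq_le qn /=.
  have := le_trans (qle (- x0)) (descent_le1 x0 rnorm_sublinear (- x0)).
  by rewrite qN addNr rnorm0 sub0r lerN2.
(* The complex-linear functional with real part [q]. *)
pose f (x : V) : R[i]^o := q x +i* (- q ('i *: x)).
have fE (a b : R) x : q ((a +i* b) *: x) = a * q x + b * q ('i *: x).
  have -> : a +i* b = a%:C + b%:C * 'i :> R[i].
    by apply/eqP; rewrite eq_complex /=; apply/andP; split; apply/eqP; ring.
  by rewrite scalerDl -scalerA qD !qZ.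
have lf : linear f.
  move=> [a b] x y; rewrite /f scalerDr !qD (fE a b) scalerA.
  have -> : 'i * (a +i* b) = (- b) +i* a :> R[i].
    by apply/eqP; rewrite eq_complex /=; apply/andP; split; apply/eqP; ring.
  rewrite (fE (- b) a); apply/eqP; rewrite eq_complex /=; apply/andP; split; apply/eqP; ring.
have [phi phiE] := linear_packP lf.
have phin x : rnorm (phi x) <= rnorm x.
  (* After rotation the modulus of [phi x] equals [q (u *: x)], where the bound on [q] applies. *)
  have [u u1 ux] := phaseP (phi x : R[i]).
  have : complex.Re (phi (u *: x)) <= rnorm x.
    rewrite phiE /=; apply: le_trans (qn _) _; rewrite rnormZ.
    by rewrite -[rnorm _ in X in X <= _]/(cabs u) u1 mul1r.
  by rewrite linearZ /= -[u *: phi x]/(u * phi x) ux.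
exists phi; split => //.
  by apply: (@bounded_rnorm_continuous _ _ _ phi 1) => x; rewrite mul1r.
apply/eqP; rewrite eq_le phin /= -{1}qx0.
apply: le_trans (ler_Re_cabs (phi x0)); rewrite phiE /=; exact: ler_norm.
Qed.

End NormingFunctional.

Lemma linear_sub_scale {K : pzRingType} {V W : lmodType K} (phi : {linear V -> W})
    (a b c d : K) (x y : V) :
  phi (a *: (b *: x) - c *: (d *: y)) = a *: (b *: phi x) - c *: (d *: phi y).
Proof. by rewrite linearB /= !linearZ_LR. Qed.

(** * Comparing the values of a vector-valued function at two atoms *)

Section AtomDistance.
Context {R : realType} {E : normedModType R[i]} {U : set E} (v : weight U).
Context {F : normedModType R[i]}.

(* Composing [f] with a norming functional of the left-hand side gives a scalar
   function on which the two functionals can be compared. *)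
Lemma Hinf_atom_dist (f : Hinf v F) (l l' : R[i]) (z z' : E) :
  rnorm (l *: ((v z)%:C *: f z) - l' *: ((v z')%:C *: f z'))
    <= rnorm (l *: atom v z - l' *: atom v z') * rnorm f.
Proof.
set w := _ - _; have [phi [cphi phin phiw]] := norming_functional w.
have gP : (phi \o f : E -> R[i]^o) \in @Hinf_pred _ _ _ v R[i]^o.
  have /set_mem[df [M fM] f0] := Hinf_mem f; apply/mem_set; split.
  - move=> x Ux; apply: differentiable_comp; first exact: df.
    exact: linear_differentiable.
  - exists M => _ [x Ux <-]; apply: le_trans (fM (v x * rnorm (f x)) _); last by exists x.
    by apply: ler_wpM2l; [exact/ltW/weight_gt0|exact: phin].
  - by move=> x Ux; rewrite /= f0// linear0.
pose g : Hinf v R[i]^o := MkHinf gP.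
have gf : rnorm g <= rnorm f.
  apply: Hinf_norm_le => [|x Ux]; first exact: Hinf_norm_ge0.
  apply: le_trans (Hinf_norm_ub f Ux).
  by apply: ler_wpM2l; [exact/ltW/weight_gt0|exact: phin].
rewrite -phiw.
have -> : phi w = (l *: atom v z - l' *: atom v z') g.
  rewrite [RHS]/(l *: ((v z)%:C *: phi (f z)) - l' *: ((v z')%:C *: phi (f z'))).
  exact: linear_sub_scale.
apply: le_trans (Ginf_ub _ _) _.
by apply: ler_wpM2l; [exact: rnorm_ge0|].
Qed.

End AtomDistance.

(** * Total boundedness *)

Section FiniteColouring.
Context {R : realType} {T : Type}.

(* Total boundedness of [h @` A], phrased through finite partitions of the index
   set [A] so that sums only require a common refinement. *)
Definition tot_bounded {V : normedModType R[i]} (A : set T) (h : T -> V) :=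
  forall e : R, 0 < e -> exists (C : finType) (c : T -> C),
    forall a b, A a -> A b -> c a = c b -> rnorm (h a - h b) <= e.

Lemma tot_boundedD {V : normedModType R[i]} (A : set T) (g h : T -> V) :
  tot_bounded A g -> tot_bounded A h -> tot_bounded A (fun a => g a + h a).
Proof.
move=> gA hA e e0; have e20 : 0 < e / 2 by rewrite divr_gt0.
have [C [c cP]] := gA _ e20; have [D [d dP]] := hA _ e20.
exists (C * D)%type, (fun a => (c a, d a)) => a b Aa Ab [/cP + /dP].
move=> /(_ Aa Ab) + /(_ Aa Ab); rewrite opprD addrACA.
have := ler_rnormD (g a - g b) (h a - h b); lra.
Qed.

Lemma tot_boundedZ {V : normedModType R[i]} (A : set T) (h : T -> V) k :
  tot_bounded A h -> tot_bounded A (fun a => k *: h a).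
Proof.
move=> hA e e0; have k0 : 0 < cabs k + 1 by have := cabs_ge0 k; lra.
have [C [c cP]] := hA _ (divr_gt0 e0 k0); exists C, c => a b Aa Ab cab; have := cP a b Aa Ab cab.
rewrite -scalerBr rnormZ -[rnorm (k : R[i]^o)]/(cabs k).
rewrite ler_pdivlMr//; have := rnorm_ge0 (h a - h b); have := cabs_ge0 k; nra.
Qed.

Lemma tot_bounded_uniform {V : normedModType R[i]} (A : set T) (h : T -> V) :
  (forall e : R, 0 < e -> exists2 g, tot_bounded A g &
     forall a, A a -> rnorm (g a - h a) <= e) ->
  tot_bounded A h.
Proof.
move=> H e e0; have e30 : 0 < e / 3 by rewrite divr_gt0.
have [g gA gh] := H _ e30; have [C [c cP]] := gA _ e30.
exists C, c => a b Aa Ab cab; have := cP a b Aa Ab cab.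
have := gh a Aa; have := gh b Ab; rewrite [X in _ -> X <= _ -> _]rnormB.
have := rnorm_dist_le (h a) (g a) (h b); have := rnorm_dist_le (g a) (g b) (h b).
lra.
Qed.

Lemma colour_real (A : set T) (u : T -> R) (M : R) : (forall a, A a -> `|u a| <= M) ->
  forall e, 0 < e -> exists (C : finType) (c : T -> C),
    forall a b, A a -> A b -> c a = c b -> `|u a - u b| <= e.
Proof.
move=> uM e e0; pose k a := Num.truncn ((u a + M) / e).
have k0 a : A a -> 0 <= (u a + M) / e.
  move=> /uM; rewrite ler_norml => /andP[? _]; rewrite divr_ge0 ?(ltW e0)//; lra.
(* The colours are the cells of length [e] that cover the interval from [- M] to [M]. *)
exists 'I_(Num.truncn (2 * M / e)).+1, (fun a => inord (k a)) => a b Aa Ab.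
have kM x : A x -> (k x < (Num.truncn (2 * M / e)).+1)%N.
  move=> Ax; rewrite ltnS; apply: le_truncn.
  rewrite ler_pM2r ?invr_gt0//; have := uM x Ax; rewrite ler_norml; lra.
move=> /(congr1 val); rewrite /= !inordK ?kM// => kab.
have /andP[] := truncn_itv (k0 a Aa); have /andP[] := truncn_itv (k0 b Ab).
rewrite -/(k a) -/(k b) kab; set n := k b; rewrite -natr1 !(ler_pdivlMr _ _ e0) !(ltr_pdivrMr _ _ e0).
rewrite ler_norml !mulrDl mul1r; lra.
Qed.

(** Provides the compactness of the rank-one perturbations: their values are bounded multiples of
    one vector. *)
Lemma tot_bounded_scalar {V : normedModType R[i]} (A : set T) (s : T -> R[i]) (M : R) (y : V) :
  (forall a, A a -> cabs (s a) <= M) -> tot_bounded A (fun a => s a *: y).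
Proof.
move=> sM e e0; have y0 : 0 < rnorm y + 1 by have := rnorm_ge0 y; lra.
have d0 : 0 < e / (2 * (rnorm y + 1)) by rewrite divr_gt0 ?mulr_gt0.
have [C [c cP]] := @colour_real A (fun a => complex.Re (s a)) M
  (fun a Aa => le_trans (ler_Re_cabs _) (sM a Aa)) _ d0.
have [D [d dP]] := @colour_real A (fun a => complex.Im (s a)) M
  (fun a Aa => le_trans (ler_Im_cabs _) (sM a Aa)) _ d0.
exists (C * D)%type, (fun a => (c a, d a)) => a b Aa Ab [/cP + /dP].
move=> /(_ Aa Ab) hr /(_ Aa Ab) hi.
rewrite -scalerBl rnormZ; apply: (@le_trans _ _ (e / (rnorm y + 1) * rnorm y)).
  apply: ler_wpM2r; first exact: rnorm_ge0.
  apply: le_trans (ler_cabs_ReIm (s a - s b)) _.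
  have -> : e / (rnorm y + 1) = e / (2 * (rnorm y + 1)) + e / (2 * (rnorm y + 1)).
    by field; rewrite gt_eqF.
  apply: lerD; [move: hr|move: hi]; by case: (s a) (s b) => [? ?] [? ?].
by rewrite mulrAC ler_pdivrMr// ler_pM2l//; lra.
Qed.

Lemma precompact_tot_bounded {V : normedModType R[i]} (A : set T) (h : T -> V) :
  precompact [set h a | a in A] -> tot_bounded A h.
Proof.
rewrite precompactE compact_cover => cK e e0.
have e20 : 0 < e / 2 by rewrite divr_gt0.
have [y _|x _|D _ DP] := cK V setT (fun y => [set x | rnorm (x - y) < e / 2]).
- rewrite openE => x /= xy; apply/rnbhsP; exists (e / 2 - rnorm (x - y)).
    by rewrite subr_gt0.
  by move=> w wx /=; have := rnorm_dist_le w x y; lra.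
- by exists x => //=; rewrite subrr rnorm0.
pose s : seq V := enum_fset D.
pose p a := [pred x : V | rnorm (h a - x) < e / 2].
(* The colour is the index of the first centre close to [h a]; the extra index is the value [size s]
   of [find], which can occur only outside [A]. *)
exists 'I_(size s).+1, (fun a => inord (find (p a) s)) => a b Aa Ab.
move=> /(congr1 val); rewrite /= !inordK ?ltnS ?find_size// => ab.
have hs c : A c -> rnorm (h c - nth 0 s (find (p c) s)) < e / 2.
  move=> Ac; have : has (p c) s.
    have [|x Dx hx] := DP (h c); first by apply: subset_closure; exists c.
    by apply/hasP; exists x.
  exact: nth_find.
have := hs a Aa; have := hs b Ab; rewrite ab; set x := nth _ _ _.
rewrite rnormB; have := rnorm_dist_le (h a) x (h b); lra.
Qed.

(** An ultrafilter on the closure that is not Cauchy avoids, for some radius, a ball around one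
    representative of each colour. As the colours are finitely many, it contains a set at positive
    distance from the whole image, which the closure forbids. Completeness then yields the limit. *)
Lemma tot_bounded_precompact {V : completeNormedModType R[i]} (A : set T) (h : T -> V) :
  tot_bounded A h -> precompact [set h a | a in A].
Proof.
move=> hA; rewrite precompactE compact_ultra => G UG GA.
have PG : ProperFilter G by exact: ultra_proper.
suff cG : cvg G.
  have [l Gl] := (cvg_ex _).1 cG; exists l; split => //.
  by apply: (@closed_cvg _ _ G _ id _ (@closed_closure _ _) GA).
apply/cauchy_cvgP/cauchy_exP => e e0.
have eE : (complex.Re e)%:C = e by apply: RRe_real; exact: gtr0_real.
have re0 : 0 < complex.Re e by rewrite -ltcR eE.
set r := complex.Re e in re0 eE; have r40 : 0 < r / 4 by rewrite divr_gt0.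
have [C [c cP]] := hA _ r40.
apply: contrapT => nG.
have nGx (i : C) : \forall y \near G, forall b, A b -> c b = i -> ~ (rnorm (y - h b) < r / 2).
  have [[a [Aa ca]]|ni] := pselect (exists a, A a /\ c a = i); last first.
    by apply: filterE => y a Aa ca; case: ni; exists a.
  have [Ga|Ga] := in_ultra_setVsetC (ball (h a) e) UG; first by case: nG; exists (h a).
  apply: filterS Ga => y; rewrite -ball_normE /ball_ /= -eE => ya b Ab cb yb.
  apply: ya; rewrite -rnormE ltcR rnormB.
  have := rnorm_dist_le y (h b) (h a); have := cP b a Ab Aa (etrans cb (esym ca)); lra.
have Gall : G [set y | forall i b, A b -> c b = i -> ~ (rnorm (y - h b) < r / 2)].
  exact: (@filter_forall _ _ _ G _ nGx).
have [y [yA yG]] := @filter_ex _ G _ _ (@filterI _ G _ _ _ GA Gall).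
have r20 : 0 < r / 2 by rewrite divr_gt0.
have [|_ [[b Ab <-] yb]] := yA [set w | rnorm (w - y) < r / 2].
  by apply/rnbhsP; exists (r / 2).
by apply: (yG (c b) b Ab erefl); rewrite rnormB.
Qed.

End FiniteColouring.

(** * The perturbation step *)

Section GeometricSequences.
Context {R : realType} {V : normedModType R[i]}.

Lemma geometric_tail (u : nat -> V) (k : R) :
  (forall n, rnorm (u n.+1 - u n) <= k / 2 ^+ n.+1) ->
  forall n m, (n <= m)%N -> rnorm (u m - u n) <= k / 2 ^+ n.
Proof.
move=> uk n m nm; rewrite -(subnKC nm); move: (m - n)%N => {m nm} j.
suff : rnorm (u (n + j)%N - u n) <= k / 2 ^+ n - k / 2 ^+ (n + j).
  move=> /le_trans; apply; rewrite lerBlDr lerDl divr_ge0 ?exprn_ge0//.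
  have := le_trans (rnorm_ge0 _) (uk 0).
  by rewrite pmulr_lge0 ?invr_gt0 ?exprn_gt0.
elim: j => [|j IHj]; first by rewrite addn0 !subrr rnorm0.
apply: le_trans (rnorm_dist_le _ (u (n + j)%N) _) _; rewrite addnS.
have := uk (n + j)%N.
have : k / 2 ^+ (n + j) = k / 2 ^+ (n + j).+1 + k / 2 ^+ (n + j).+1.
  by rewrite exprS; field; rewrite expf_neq0.
by move: IHj; lra.
Qed.

Lemma geometric_small (k e : R) : 0 < e -> exists n, k / 2 ^+ n <= e.
Proof.
move=> e0; exists (Num.bound (`|k| / e)).
rewrite ler_pdivrMr ?exprn_gt0// mulrC -ler_pdivrMr//.
apply: (@le_trans _ _ (`|k| / e)); first by rewrite ler_pM2r ?invr_gt0// ler_norm.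
have := archi_boundP (divr_ge0 (normr_ge0 k) (ltW e0)); set n := Num.bound _ => kn.
by apply: le_trans (ltW kn) _; rewrite -natrX ler_nat ltnW// ltn_expl.
Qed.

Lemma geometric_cauchy (u : nat -> V) (k : R) :
  (forall n, rnorm (u n.+1 - u n) <= k / 2 ^+ n.+1) -> cauchy_rnorm u.
Proof.
move=> uk e e0; have [n nk] := geometric_small k e0.
by exists n => m nm; apply: le_trans nk; exact: geometric_tail.
Qed.

Lemma geometric_limit (u : nat -> V) (l : V) (k : R) :
  (forall n, rnorm (u n.+1 - u n) <= k / 2 ^+ n.+1) -> u @ \oo --> l ->
  forall n, rnorm (l - u n) <= k / 2 ^+ n.
Proof.
move=> uk /cvg_rnormP ul n; apply/ler_addgt0Pr => e e0.
have [N NP] := ul _ e0; have := NP (maxn N n) (leq_maxl _ _).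
have := geometric_tail uk (leq_maxr N n); rewrite [X in _ -> X <= _ -> _]rnormB.
have := rnorm_dist_le l (u (maxn N n)) (u n); lra.
Qed.

End GeometricSequences.

Section Iteration.
Context {R : realType} {E : normedModType R[i]} {U : set E} (v : weight U).
Context {F : completeNormedModType R[i]}.
Hypothesis openU : open U.
Local Notation G := (Ginf v).
Local Notation H := (Hinf v F).

Lemma atomE z (f : Hinf v R[i]^o) : atom v z f = (v z)%:C *: f z.
Proof. by []. Qed.

Lemma weighted_value_norm z (y : F) : U z -> rnorm ((v z)%:C *: y) = v z * rnorm y.
Proof. by move=> Uz; rewrite rnormZ rnorm_real// ltW// weight_gt0. Qed.

Lemma atom_le1 z : U z -> rnorm (atom v z) <= 1.
Proof.
move=> Uz; apply: Ginf_le => f f1; rewrite atomE rnormZ rnorm_real.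
  exact: le_trans (Hinf_norm_ub f Uz) f1.
exact/ltW/weight_gt0.
Qed.

Lemma delta_out z : ~ U z -> delta v z = 0.
Proof.
move=> nUz; apply: val_inj; apply/funext => f /=.
by have /set_mem[_ _ ->] := Hinf_mem f.
Qed.

Lemma homogeneous_bound (S : G -> F) (k : R) z : 0 <= k ->
  (forall a xi, S (a *: xi) = a *: S xi) ->
  (forall xi, rnorm (S xi) <= k * rnorm xi) -> U z ->
  v z * rnorm (S (delta v z)) <= k.
Proof.
move=> k0 SZ Sk Uz; rewrite -weighted_value_norm// -SZ; apply: le_trans (Sk _) _.
by rewrite -[leRHS]mulr1; apply: ler_wpM2l => //; exact: atom_le1.
Qed.

Lemma operator_Hinf (f : H) (T : {linear G -> F}) (k : R) : 0 <= k ->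
  (forall xi, rnorm (T xi) <= k * rnorm xi) ->
  exists g : H, forall z, g z = f z + T (delta v z).
Proof.
move=> k0 Tk; have /set_mem[df [M fM] f0] := Hinf_mem f.
suff gP : (fun z => f z + T (delta v z)) \in @Hinf_pred _ _ _ v F.
  by exists (MkHinf gP).
apply/mem_set; split=> [z Uz||z nUz].
- have dT : differentiable (T \o delta v) z.
    apply: differentiable_comp; first exact: delta_differentiable.
    by apply: linear_differentiable; exact: bounded_rnorm_continuous Tk.
  exact: differentiableD (df z Uz) dT.
- exists (M + k) => _ [z Uz <-]; have vz := ltW (weight_gt0 v Uz).
  apply: (@le_trans _ _ (v z * (rnorm (f z) + rnorm (T (delta v z))))).
    by apply: ler_wpM2l => //; exact: ler_rnormD.
  rewrite mulrDr; apply: lerD; first by apply: fM; exists z.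
  by apply: homogeneous_bound => // a xi; rewrite linearZ_LR.
- by rewrite f0// delta_out// linear0 addr0.
Qed.

(** Total boundedness passes easily to sums and uniform limits; completeness of [F] gives the way
    back to compact closures. *)
Lemma HinfKE (f : H) : HinfK v F f <-> tot_bounded U (fun z => (v z)%:C *: f z).
Proof. by split; [exact: precompact_tot_bounded|exact: tot_bounded_precompact]. Qed.

Lemma HinfKZ a (f : H) : HinfK v F f -> HinfK v F (a *: f).
Proof.
rewrite !HinfKE => /(tot_boundedZ a) fK e /fK[C [c cP]]; exists C, c => z w Uz Uw.
move=> /(cP z w Uz Uw); rewrite -[(a *: f) z]/(a *: f z) -[(a *: f) w]/(a *: f w).
by rewrite !scalerA !(mulrC a).
Qed.

Lemma HinfK_closed (f : H) :
  (forall e : R, 0 < e -> exists2 g : H, HinfK v F g & rnorm (g - f) <= e) ->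
  HinfK v F f.
Proof.
move=> H; apply/HinfKE; apply: tot_bounded_uniform => e /H[g /HinfKE gK gf].
exists (fun z => (v z)%:C *: g z) => // z Uz.
rewrite -scalerBr weighted_value_norm//.
exact: le_trans (Hinf_norm_ub (g - f) Uz) gf.
Qed.

End Iteration.

(** * Consequences of the conventions on [opnorm] and [diam] *)

Section DualBound.
Context {R : realType} {X : normedModType R[i]}.

(** Since [sup] is 0 on unbounded sets, the value 1 of [opnorm] already forces [psi] to be bounded
    on the unit ball. *)
Lemma dual_bound (psi : {linear X -> R[i]^o}) : dual_unit_sphere X psi ->
  forall x, cabs (psi x) <= rnorm x.
Proof.
move=> [_ psi1] x.
have bpsi : has_ubound [set rnorm (psi x) | x in closed_unit_ball X].
  apply: contrapT => nb; move: psi1; rewrite /opnorm sup_out; last by case.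
  by move/eqP; rewrite eq_sym oner_eq0.
have [x0|x0] := eqVneq (rnorm x) 0.
  by rewrite (rnorm0_eq0 x0) linear0 /cabs !rnorm0.
have {x0}x0 : 0 < rnorm x by rewrite lt_def x0 rnorm_ge0.
have := @opnorm_ub _ _ psi ((rnorm x)^-1%:C *: x) bpsi.
rewrite linearZ_LR !rnormZ rnorm_real ?invr_ge0 ?rnorm_ge0// mulVf ?gt_eqF//.
by rewrite psi1 => /(_ (lexx _)); rewrite ler_pdivrMl// mulr1.
Qed.

Lemma slice_close (psi : X -> R[i]^o) (d eps : R) (x y : X) :
  rnorm x <= 1 -> rnorm y <= 1 -> diam (slice psi d) < eps ->
  1 - d < complex.Re (psi x) -> 1 - d < complex.Re (psi y) -> rnorm (x - y) < eps.
Proof.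
move=> x1 y1 deps xd yd; apply: le_lt_trans deps; apply: ub_le_sup; last first.
  by exists x => //; exists y.
exists 2 => _ [a [a1 _] [b [b1 _] <-]].
apply: le_trans (ler_rnormD _ _) _; rewrite rnormN.
by have := lerD a1 b1.
Qed.

End DualBound.

Section Perturbation.
Context {R : realType} {E : normedModType R[i]} {U : set E} (v : weight U).
Context {F : completeNormedModType R[i]}.
Hypothesis openU : open U.
Local Notation G := (Ginf v).
Local Notation H := (Hinf v F).

Variable phi : G -> {linear G -> R[i]^o}.
Hypothesis phiP : forall x, circle_atoms v x -> dual_unit_sphere G (phi x) /\ phi x x = 1.

Definition state := (H * {linear G -> F} * (R[i] * E))%type.
Definition state_atom (s : state) : G := s.2.1 *: atom v s.2.2.

(* The current function is [s.1.1 = f + s.1.2 \o delta], and it nearly attains its norm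
   at [s.2.2]. *)
Definition state_inv (f : H) (eta : R) (s : state) : Prop :=
  [/\ exists2 k : R, 0 <= k & forall xi, rnorm (s.1.2 xi) <= k * rnorm xi,
      forall z, s.1.1 z = f z + s.1.2 (delta v z),
      HinfK v F s.1.1,
      1 <= rnorm s.1.1 &
      [/\ `|s.2.1| = 1, U s.2.2 & rnorm s.1.1 - eta < v s.2.2 * rnorm (s.1.1 s.2.2)]].

Lemma state_circle f eta s : state_inv f eta s -> circle_atoms v (state_atom s).
Proof. by case=> _ _ _ _ [l1 Uz _]; exists s.2.1 => //; exists s.2.2. Qed.

Lemma circle_atom_le1 x : circle_atoms v x -> rnorm x <= 1.
Proof.
move=> [l l1 [z Uz <-]]; rewrite rnormZ [X in X * _](_ : _ = 1).
  by rewrite mul1r atom_le1.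
by apply: complexI; rewrite rnormE.
Qed.

(* Adding [rho] times the functional exposing the current atom forces every new near
   maximiser, suitably rotated, into a thin slice around that atom. *)
Lemma perturbation_step (f : H) (eta eta' rho d eps : R) (s : state) :
  0 < rho -> 0 < eta' -> eta < 1 -> eta <= rho -> eta + eta' < rho * d -> 0 < d ->
  (forall x, circle_atoms v x -> diam (slice (phi x) d) < eps) ->
  state_inv f eta s ->
  exists s', [/\ state_inv f eta' s',
    forall xi, rnorm (s'.1.2 xi - s.1.2 xi) <= rho * rnorm xi &
    rnorm (state_atom s' - state_atom s) < eps].
Proof.
move=> rho0 eta'0 eta1 etarho etad d0 Hd sinv; have xS := state_circle sinv.
case: s sinv xS => [[g T] [l z]] [[k k0 Tk] gE gK g1 [l1 Uz gz]].
rewrite /state_atom /= in gE gK g1 l1 Uz gz *; set x := l *: atom v z => xS.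
have [dphi phix] := phiP xS; have phin := dual_bound dphi.
have cl1 : rnorm (l : R[i]^o) = 1 by apply: complexI; rewrite rnormE.
pose w := l *: ((v z)%:C *: g z).
have wn : rnorm w = v z * rnorm (g z) by rewrite rnormZ cl1 mul1r weighted_value_norm.
(* The lower bound 1 in the invariant, together with [eta < 1], ensures that [w] has a direction. *)
have w0 : 0 < rnorm w by rewrite wn; lra.
have [y y1 wy] : exists2 y : F, rnorm y = 1 & w = (rnorm w)%:C *: y.
  exists ((rnorm w)^-1%:C *: w).
    by rewrite rnormZ rnorm_real ?invr_ge0 ?rnorm_ge0// mulVf// gt_eqF.
  by rewrite scalerA -rmorphM /= divff ?gt_eqF// scale1r.
have lS : linear (fun xi => T xi + rho%:C *: (phi x xi *: y)).
  move=> a xi zeta; have phiD : phi x (a *: xi + zeta) = a * phi x xi + phi x zeta.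
    by rewrite linearP.
  rewrite phiD linearP scalerDl !scalerDr addrACA; congr (_ + _ + (_ + _)).
  by rewrite !scalerA; congr (_ *: _); rewrite mulrA (mulrC a).
have [T' T'E] := linear_packP lS.
have dT xi : rnorm (T' xi - T xi) <= rho * rnorm xi.
  rewrite T'E addrAC subrr add0r !rnormZ rnorm_real ?(ltW rho0)// y1 mulr1.
  by rewrite ler_pM2l//; exact: phin.
have T'k xi : rnorm (T' xi) <= (k + rho) * rnorm xi.
  rewrite mulrDl; have := Tk xi; have := dT xi.
  by have := ler_rnormD (T' xi - T xi) (T xi); rewrite subrK; lra.
have kr0 : 0 <= k + rho by rewrite addr_ge0// ltW.
have [g' g'E] := operator_Hinf openU f kr0 T'k.
have g'g u : g' u = g u + rho%:C *: (phi x (delta v u) *: y).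
  by rewrite g'E T'E gE addrA.
have phiA u : phi x (atom v u) = (v u)%:C * phi x (delta v u).
  by rewrite linearZ_LR.
have vg' u : (v u)%:C *: g' u = (v u)%:C *: g u + (rho%:C * phi x (atom v u)) *: y.
  rewrite g'g scalerDr phiA; congr (_ + _); rewrite !scalerA; congr (_ *: _).
  by rewrite mulrA (mulrC rho%:C).
have g'K : HinfK v F g'.
  apply/HinfKE; have gt := (HinfKE g).1 gK.
  have st : tot_bounded U (fun u => (rho%:C * phi x (atom v u)) *: y).
    apply: (@tot_bounded_scalar _ _ _ _ _ rho) => u Uu.
    rewrite cabsM cabs_real gtr0_norm// -[leRHS]mulr1 ler_pM2l//.
    exact: le_trans (phin _) (atom_le1 v Uu).
  move=> e e0; have [C [c cP]] := tot_boundedD gt st e0.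
  by exists C, c => a b Ua Ub cab; rewrite !vg'; exact: cP.
(* At the current atom the perturbation points along [w], so the norms add and the gain is the full
   [rho]. *)
have g'z : v z * rnorm (g' z) = rnorm w + rho.
  have -> : v z * rnorm (g' z) = rnorm (l *: ((v z)%:C *: g' z)).
    by rewrite rnormZ cl1 mul1r weighted_value_norm.
  have -> : l *: ((v z)%:C *: g' z) = (rnorm w + rho)%:C *: y.
    rewrite vg' scalerDr -/w [X in X + _]wy scalerA.
    have -> : l * (rho%:C * phi x (atom v z)) = rho%:C * phi x x.
      by rewrite mulrCA; congr (_ * _); apply/esym; exact: (linearZ_LR (phi x)).
    by rewrite phix mulr1 -scalerDl rmorphD.
  by rewrite rnormZ y1 mulr1 rnorm_real// addr_ge0 ?ltW.
have g'n : rnorm w + rho <= rnorm g' by rewrite -g'z; exact: Hinf_norm_ub.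
have [z' Uz' g'z'] : exists2 z', U z' & rnorm g' - eta' < v z' * rnorm (g' z').
  have hs : has_sup [set v u * rnorm (g' u) | u in U].
    split; first by exists (v z * rnorm (g' z)), z.
    by have /set_mem[] := Hinf_mem g'.
  by have [_ [z' Uz' <-] lt] := sup_adherent eta'0 hs; exists z'.
have [l' l'1 l'E] := phaseP (phi x (atom v z')).
have upper : v z' * rnorm (g' z') <= rnorm g + rho * cabs (phi x (atom v z')).
  rewrite -weighted_value_norm// vg'; apply: le_trans (ler_rnormD _ _) _.
  rewrite weighted_value_norm// rnormZ y1 mulr1 -[rnorm _ in X in _ + X <= _]/(cabs _).
  rewrite cabsM cabs_real gtr0_norm// lerD2r; exact: Hinf_norm_ub.
(* The norm of [g'] exceeds [rnorm g - eta + rho], while its weighted value at [z'] is within [eta']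
   of that norm and at most the bound [upper]. Hence [rho] times the modulus exceeds
   [rho - eta - eta'], and [eta + eta' < rho * d]. *)
have near1 : 1 - d < cabs (phi x (atom v z')).
  by rewrite -(ltr_pM2l rho0) mulrBr mulr1; lra.
have l'n : `|l'| = 1 by rewrite normr_cabs l'1.
exists ((g', T'), (l', z')); split => //=.
  split => //=; first by exists (k + rho).
    (* The norm stays at least 1: it exceeds [rnorm g - eta + rho], and [eta <= rho]. *)
    by apply: le_trans g'n; lra.
apply: slice_close (Hd _ xS) _ _.
- by apply: circle_atom_le1; exists l' => //; exists z'.
- exact: circle_atom_le1.
- by rewrite linearZ_LR -[l' *: _]/(l' * _) l'E.
- by rewrite phix /=; lra.
Qed.

End Perturbation.

(** * Passing to the limit *)

Lemma subrDD {V : zmodType} (a b c : V) : (a + b) - (a + c) = b - c.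
Proof. by rewrite opprD addrACA subrr add0r. Qed.

Lemma operator_limit {R : realType} {X : normedModType R[i]}
    {F : completeNormedModType R[i]} (T : nat -> {linear X -> F}) (k : R) :
  (forall n x, rnorm (T n.+1 x - T n x) <= k / 2 ^+ n.+1 * rnorm x) ->
  exists L : {linear X -> F}, forall n x, rnorm (L x - T n x) <= k / 2 ^+ n * rnorm x.
Proof.
move=> Tk; have geo x n : rnorm (T n.+1 x - T n x) <= (k * rnorm x) / 2 ^+ n.+1.
  by rewrite mulrAC; exact: Tk.
have pt x : exists l : F, T n x @[n --> \oo] --> l.
  by have /cvg_ex[l Tl] := cauchy_rnorm_cvg (geometric_cauchy (geo x)); exists l.
have [L LP] := choice pt.
have lL : linear L.
  move=> a x y; have H1 := LP (a *: x + y).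
  have H2 := cvg_axpy (a := a) (LP x) (LP y).
  apply: cvg_seq_unique H1 _; apply: cvg_trans H2.
  by rewrite (_ : (fun n => T n _) = (fun n => a *: T n x + T n y))//;
     apply/funext => n; rewrite linearP.
have [L' L'E] := linear_packP lL; exists L' => n x; rewrite L'E mulrAC.
exact: geometric_limit (geo x) (LP x) n.
Qed.

Section MainArgument.
Context {R : realType} {E : normedModType R[i]} {U : set E} (v : weight U).
Context {F : completeNormedModType R[i]}.
Hypothesis openU : open U.
Hypothesis closed_atoms : closed (circle_atoms v).
Hypothesis exposed_atoms : uniformly_strongly_exposed (circle_atoms v).
Local Notation G := (Ginf v).
Local Notation H := (Hinf v F).

Section Epsilon.
Variable eps : R.
Hypothesis eps01 : 0 < eps < 1.

Let eps0 : 0 < eps. Proof. by case/andP: eps01. Qed.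
Let eps1 : eps < 1. Proof. by case/andP: eps01. Qed.

Let pow2_gt0 n : 0 < 2 ^+ n :> R. Proof. by rewrite exprn_gt0. Qed.

(** The [rho n] sum to [eps / 4] and the [gap n] to [eps / 2]: the function moves by at most
    [eps / 4], its final normalisation by as much again, and the atom by at most [eps / 2]. *)
Let rho n : R := eps / 4 / 2 ^+ n.+1.
Let gap n : R := eps / 2 / 2 ^+ n.+1.

Let pow2_ge2 n : 2 <= 2 ^+ n.+1 :> R.
Proof. by rewrite -natrX (ler_nat R 2) -[2%N]expn1 leq_exp2l. Qed.

Let rho_gt0 n : 0 < rho n. Proof. by rewrite !divr_gt0. Qed.
Let gap_gt0 n : 0 < gap n. Proof. by rewrite !divr_gt0. Qed.

Let rho_le n : rho n <= eps / 4.
Proof.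
rewrite ler_pdivrMr// ler_peMr ?divr_ge0 ?(ltW eps0)//.
by apply: le_trans (pow2_ge2 n); rewrite ler1n.
Qed.

Let gap_lt1 n : gap n < 1.
Proof.
rewrite ltr_pdivrMr// mul1r; apply: lt_le_trans (pow2_ge2 n).
by have := eps1; lra.
Qed.

Lemma WHinf_BPB_eps : exists2 eta : R, 0 < eta < eps &
    forall (f : H) (l : R[i]) (z : E),
      HinfK v F f -> rnorm f = 1 -> `|l| = 1 -> U z -> 1 - eta < v z * rnorm (f z) ->
      exists (f0 : H) (l0 : R[i]) (z0 : E),
        [/\ HinfK v F f0, rnorm f0 = 1, `|l0| = 1 & U z0] /\
        [/\ v z0 * rnorm (f0 z0) = 1, rnorm (f - f0) < eps &
            rnorm (l *: atom v z - l0 *: atom v z0) < eps].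
Proof.
have [_ [phi [phiP phi_diam]]] := exposed_atoms.
(* One width [d n] serves all atoms at once, so [eta 0] depends on [eps] but not on the function or
   the point. *)
have dP n : exists d : R, 0 < d < 1 /\
    forall x, circle_atoms v x -> diam (slice (phi x) d) < gap n.
  by have [|d d01 dn] := phi_diam (gap n); [rewrite gap_gt0 gap_lt1|exists d].
have [d {}dP] := choice dP.
have d_gt0 n : 0 < d n by have [/andP[]] := dP n.
have d_lt1 n : d n < 1 by have [/andP[]] := dP n.
(* The quarter of [rho n * d n], made nonincreasing by the minimum, ensures
   [eta n + eta n.+1 < rho n * d n] at every step. *)
pose eta := fix eta n : R := if n is m.+1 then Num.min (eta m) (rho m.+1 * d m.+1 / 4)
  else rho 0 * d 0 / 4.
have rd_gt0 n : 0 < rho n * d n by rewrite mulr_gt0.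
have eta_le n : eta n <= rho n * d n / 4.
  by case: n => [//|n] /=; rewrite ge_min lexx orbT.
have eta_mono n : eta n.+1 <= eta n by rewrite /= ge_min lexx.
have eta_gt0 n : 0 < eta n.
  by elim: n => [|n IHn] /=; rewrite ?lt_min ?IHn divr_gt0.
have rd_lt n : rho n * d n < rho n by rewrite gtr_pMr.
have eta_rho n : eta n <= rho n.
  by have := eta_le n; have := rd_lt n; have := rd_gt0 n; lra.
have eta_lt1 n : eta n < 1.
  by have := eta_rho n; have := rho_le n; have := eps1; lra.
have eta_sum n : eta n + eta n.+1 < rho n * d n.
  by have := eta_le n; have := eta_mono n; have := rd_gt0 n; lra.
exists (eta 0%N) => [|f l z fK f1 l1 Uz fz].
  by rewrite eta_gt0; have := eta_rho 0%N; have := rho_le 0; have := eps0; lra.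
pose T0 : {linear G -> F} := \0.
pose s0 : state v (F := F) := ((f, T0), (l, z)).
have s0P : state_inv f (eta 0%N) s0.
  split => //=.
  - by exists 0 => // xi; rewrite rnorm0 mul0r.
  - by move=> w; rewrite addr0.
  - by rewrite f1.
  - by rewrite f1.
have stepP (ns : nat * state v (F := F)) : exists s', state_inv f (eta ns.1) ns.2 ->
    [/\ state_inv f (eta ns.1.+1) s',
      forall xi, rnorm (s'.1.2 xi - ns.2.1.2 xi) <= rho ns.1 * rnorm xi &
      rnorm (state_atom s' - state_atom ns.2) < gap ns.1].
  case: ns => n s /=; have [sP|nsP] := pselect (state_inv f (eta n) s); last by exists s.
  have [s' s'P] := perturbation_step openU phiP (rho_gt0 n) (eta_gt0 n.+1) (eta_lt1 n)
    (eta_rho n) (eta_sum n) (d_gt0 n) (proj2 (dP n)) sP.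
  by exists s'.
have [nxt nxtP] := choice stepP.
pose s := fix s n := if n is m.+1 then nxt (m, s m) else s0.
have sP n : state_inv f (eta n) (s n).
  by elim: n => [//|n IHn]; have [] := nxtP (n, s n) IHn.
have sT n xi : rnorm ((s n.+1).1.2 xi - (s n).1.2 xi) <= eps / 4 / 2 ^+ n.+1 * rnorm xi.
  by have [_ + _] := nxtP (n, s n) (sP n); apply.
have sx n : rnorm (state_atom (s n.+1) - state_atom (s n)) <= eps / 2 / 2 ^+ n.+1.
  by have [_ _] := nxtP (n, s n) (sP n); exact: ltW.
have [L LP] := operator_limit (T := fun n => (s n).1.2) sT.
have Lk xi : rnorm (L xi) <= eps / 4 * rnorm xi.
  by have := LP 0%N xi; rewrite /= subr0 expr0 divr1.
have e40 : 0 <= eps / 4 by rewrite divr_ge0// ltW.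
have [g gE] := operator_Hinf openU f e40 Lk.
have gs n : rnorm (g - (s n).1.1) <= eps / 4 / 2 ^+ n.
  have [_ sE _ _ _] := sP n; have k0 : 0 <= eps / 4 / 2 ^+ n by rewrite divr_ge0// ltW.
  apply: Hinf_norm_le => // w Uw.
  rewrite [X in rnorm X](_ : _ = L (delta v w) - (s n).1.2 (delta v w)).
    apply: (@homogeneous_bound _ _ _ _ _ (fun xi => L xi - (s n).1.2 xi)) => //.
    by move=> a xi; rewrite (linearZ_LR L) (linearZ_LR (s n).1.2) scalerBr.
  rewrite [LHS]/(g w - (s n).1.1 w) gE sE; exact: subrDD.
have [x xs] := Ginf_complete (geometric_cauchy sx).
have xdist := geometric_limit sx xs.
have : circle_atoms v x.
  apply: (@closed_cvg _ _ \oo _ (fun n => state_atom (s n)) _ closed_atoms _ _ xs).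
  by apply: filterE => n; exact: state_circle (sP n).
move=> [l0 l01 [z0 Uz0 xE]].
have clc (a : R[i]) w : `|a| = 1 -> U w ->
    rnorm (a *: ((v w)%:C *: g w)) = v w * rnorm (g w).
  move=> a1 Uw; rewrite rnormZ weighted_value_norm//.
  by rewrite (_ : rnorm _ = 1) ?mul1r//; apply: complexI; rewrite rnormE.
have attained : v z0 * rnorm (g z0) = rnorm g.
  apply/eqP; rewrite eq_le Hinf_norm_ub//=; apply/ler_addgt0Pr => e e0.
  (* Up to the factor [2 ^- n] each, there are three errors of size [eps / 4], namely replacing the
     norm of [g] by that of the current function, the tolerance [eta n], and returning to [g] at
     [w]; moving from the current atom to the limit atom costs [eps / 2 * rnorm g]. *)
  pose k := 3 / 4 * eps + eps / 2 * rnorm g.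
  have [n nk] := geometric_small k e0.
  have [_ _ _ _ [sl sU sn]] := sP n.
  set w := (s n).2.2 in sU sn; have vw := weight_gt0 v sU.
  have sg := gs n.
  have value_dist : v w * rnorm ((s n).1.1 w - g w) <= rnorm (g - (s n).1.1).
    by rewrite (rnormB g); exact: (Hinf_norm_ub ((s n).1.1 - g) sU).
  have value_sub := ler_wpM2l (ltW vw) (ler_dist_rnorm ((s n).1.1 w) (g w)).
  have norm_sub := ler_dist_rnorm g (s n).1.1.
  have atom_sub : v w * rnorm (g w) - v z0 * rnorm (g z0) <= eps / 2 / 2 ^+ n * rnorm g.
    rewrite -(clc (s n).2.1 w)// -(clc l0 z0)//.
    apply: le_trans (ler_dist_rnorm _ _) _.
    apply: le_trans (Hinf_atom_dist g (s n).2.1 l0 w z0) _.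
    by apply: ler_wpM2r; [exact: rnorm_ge0|rewrite xE -[_ *: _]/(state_atom (s n)) rnormB].
  have eta_t : eta n <= eps / 4 / 2 ^+ n.
    apply: le_trans (eta_rho n) _; rewrite ler_wpM2l// lef_pV2 ?posrE//.
    by rewrite exprS ler_peMl// ?ler1n// ltW.
  move: value_sub nk; rewrite /k mulrBr mulrDl.
  move: sg atom_sub eta_t; set t := (2 ^+ n)^-1; lra.
have gf : rnorm (g - f) <= eps / 4 by have := gs 0%N; rewrite expr0 divr1.
have g_near1 : `|rnorm g - 1| <= eps / 4.
  have := ler_dist_rnorm g f; have := ler_dist_rnorm f g.
  by rewrite ler_norml (rnormB f g) f1; lra.
have g_gt0 : 0 < rnorm g.
  by move: g_near1; rewrite ler_norml; have := eps1; lra.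
have gK : HinfK v F g.
  apply: HinfK_closed => e e0; have [n nk] := geometric_small (eps / 4) e0.
  exists (s n).1.1; first by have [] := sP n.
  by rewrite rnormB; exact: le_trans (gs n) nk.
exists ((rnorm g)^-1%:C *: g), l0, z0; split; split=> //.
- exact: HinfKZ.
- by rewrite rnormZ rnorm_real ?invr_ge0 ?rnorm_ge0// mulVf// gt_eqF.
- rewrite -[X in rnorm X]/((rnorm g)^-1%:C *: g z0) rnormZ rnorm_real ?invr_ge0 ?rnorm_ge0//.
  by rewrite mulrCA attained mulVf// gt_eqF.
- apply: le_lt_trans (rnorm_dist_le _ g _) _; rewrite rnormB.
  have -> : g - (rnorm g)^-1%:C *: g = (1 - (rnorm g)^-1)%:C *: g.
    by rewrite rmorphB scalerBl scale1r.
  rewrite rnormZ -[rnorm _ in X in _ + X * _]/(cabs _) cabs_real -[X in _ * X](gtr0_norm g_gt0).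
  rewrite -normrM mulrBl mul1r mulVf ?gt_eqF//.
  by have := eps0; lra.
- rewrite xE rnormB; have := xdist 0%N; rewrite expr0 divr1 /state_atom /=.
  by have := eps0; lra.
Qed.

End Epsilon.
End MainArgument.

Theorem proposition3p2 (R : realType) (E : completeNormedModType R[i])
    (U : set E) (openU : open U) (v : weight U)
    (closed_atoms : closed (circle_atoms v))
    (exposed_atoms : uniformly_strongly_exposed (circle_atoms v))
    (F : completeNormedModType R[i]) :
  WHinf_BPB (HinfK v F).
Proof. by move=> eps eps01; exact: WHinf_BPB_eps. Qed.
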